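(* Let $\mu,\varepsilon\in\{+,-\}$, and let $X_j=B_{\mu_j,\varepsilon_j}^{\nu_j,v_j}$, $j=1,2$, be simple objects of $\mathcal{E}(\mathrm{SL}(2,q))$ with $\mu_1\mu_2=\mu$ and $\varepsilon_1\varepsilon_2=\varepsilon$. Put $X=X_1\odot X_2$ and $\nu=\nu_1\nu_2$. Let $\mathbb{H}'$ be the set of $i\in[1,2h]$ with $(e^{\acute\varepsilon}-e^{2i+\acute{\varepsilon_2}})e^{-\acute{\varepsilon_1}}\in\mathbb{F}_q^{\times2}$, and for $i\in\mathbb{H}'$ let $\hat i\in[1,2h]$ be defined by $e^{\acute\varepsilon}-e^{2i+\acute{\varepsilon_2}}=e^{2\hat i+\acute{\varepsilon_1}}$. Then there is an isomorphism $$X_{[\mu\mathbf b_\varepsilon]}\cong\bigoplus_{d\in\mathbb{H}'}B_{\mu,\varepsilon}^{\nu,\,e^{-2\hat d}v_1+e^{-2d}v_2},\qquad \mu_1\mathbf b(e^{2\hat i+\acute{\varepsilon_1}})\otimes\mu_2\mathbf b(e^{2i+\acute{\varepsilon_2}})\mapsto\bigoplus_{d\in\mathbb{H}'}\delta_{d,i}\quad(i\in\mathbb{H}').$$ With respect to this isomorphism and the analogous one for $X_2\odot X_1$ (obtained by exchanging the indices $1$ and $2$, so that the summands of $(X_2\odot X_1)_{[\mu\mathbf b_\varepsilon]}$ are indexed by $\{\hat d:d\in\mathbb{H}'\}$), the restriction of the braiding $R_{X_1,X_2}$ to $X_{[\mu\mathbf b_\varepsilon]}$ is $$R_{[\mu\mathbf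 b_\varepsilon]}=\bigoplus_{d\in\mathbb{H}'}\frac{\mu^{\acute{\nu_2}}}{\theta_{X_2}}\,\zeta_p^{\mathrm{tr}(e^{\acute\varepsilon-2d}v_2)}\,J(d,\hat d),$$ where $J(d,\hat d):B_{\mu,\varepsilon}^{\nu,\,e^{-2\hat d}v_1+e^{-2d}v_2}\to B_{\mu,\varepsilon}^{\nu,\,e^{-2d}v_2+e^{-2\hat d}v_1}$ is the identity map from the summand of $X_1\odot X_2$ indexed by $d$ to the summand of $X_2\odot X_1$ indexed by $\hat d$.
   Context: General setting. For a finite group $\Gamma$, $\mathcal{E}(\Gamma)$ is the category of finite-dimensional representations of the quantum double $D(\Gamma)$. Its objects are $\Gamma$-graded finite-dimensional complex vector spaces $U=\bigoplus_{x\in\Gamma}U_x$ with a left linear action $g\mapsto L^U_g$ of $\Gamma$ with $L^U_g(U_x)=U_{gxg^{-1}}$; morphisms are grading-preserving equivariant linear maps. Tensor product: $(U\odot V)_x=\bigoplus_{x_1x_2=x}U_{x_1}\otimes V_{x_2}$ with diagonal action. Braiding: $R_{U,V}:U\odot V\to V\odot U$ sends $u\otimes v\in U_x\otimes V_y$ to $L^V_x(v)\otimes u\in V_{xyx^{-1}}\otimes U_x$. For $x\in\Gamma$ and an irreducible representation $\rho$ of the centralizer $\mathrm{Cen}(x)$ on $U(\rho)$, $U(x,\rho)$ is the simple object with $U(x,\rho)_y=U(\rho)$ for $y\in[x]$ (the conjugacy class of $x$), $0$ otherwise, with the induced action: fix left coset representatives $R_x$ of $\mathrm{Cen}(x)$;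 for $g\in\Gamma$, $a\in R_x$ write $ga=a'b$ with $a'\in R_x$, $b\in\mathrm{Cen}(x)$, and let $L_g:U(x,\rho)_{axa^{-1}}\to U(x,\rho)_{a'xa'^{-1}}$ be $\rho(b)$. For $U=U(x,\rho)$, $\theta_U=\mathrm{tr}(\rho(x))$. For an object $X$, $X_{[x]}=\bigoplus_{y\in[x]}X_y$ is the subobject supported on $[x]$; a morphism out of $X_{[x]}$ is determined by its restriction to $X_x$. Notation for $\mathrm{SL}(2,q)$. $q=p^n\ge5$, $p$ an odd prime, $q=4h+1$; $\Gamma=\mathrm{SL}(2,q)$. For integers $a<b$, $[a,b]=\{a,a+1,\dots,b\}$. $\mathbb{F}_q^{\times2}$ is the set of nonzero squares. $\acute{+}=0$, $\acute{-}=1$; signs $\pm$ are identified with $\pm1$. $\check e$ is a fixed generator of $\mathbb{F}_{q^2}^\times$ and $e=\check e^{4h+2}$ (a generator of $\mathbb{F}_q^\times$); $\zeta_p=\exp(2\pi i/p)$; $\mathrm{tr}:\mathbb{F}_q\to\mathbb{F}_p$ is the trace. $\mathbf{b}(y)=\begin{pmatrix}1&y\\0&1\end{pmatrix}$, $\mathbf{b}_\varepsilon=\mathbf{b}(e^{\acute\varepsilon})$ for $\varepsilon\in\{+,-\}$; $\mathrm{Cen}(\mu\mathbf b_\varepsilon)=\{\pm\mathbf b(c):c\in\mathbb{F}_q\}$. For $\mu,\varepsilon,\nu\in\{+,-\}$ and $v\in\mathbb{F}_q$, $B^{\nu,v}_{\mu,\varepsilon}=U(\mu\mathbf b_\varepsilon,(\nu,v)^*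 )$, where $(\nu,v)^*(\eta\mathbf b(c))=\eta^{\acute\nu}\zeta_p^{\mathrm{tr}(vc)}$ ($\eta=\pm1$). Conventions for this statement: each nonzero component of $B^{\nu_j,v_j}_{\mu_j,\varepsilon_j}$ is one-dimensional, and its basis vector at degree $y$ is denoted by $y$ itself; for those $y=\mu_j\mathbf b(e^{2i+\acute{\varepsilon_j}})$ the basis vector is $1\in\mathbb{C}$. In the displayed isomorphism, $\bigoplus_d\delta_{d,i}$ denotes the vector whose component in the degree-$\mu\mathbf b_\varepsilon$ part $\mathbb{C}$ of the $d$-th summand is $\delta_{d,i}$. *)

(* Defs.v *)
From HB Require Import structures.
From mathcomp Require Import all_boot all_order all_algebra all_fingroup.
From mathcomp Require Import all_solvable all_field mxrepresentation.
From mathcomp Require Import complex reals trigo.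

Set Implicit Arguments.
Unset Strict Implicit.
Unset Printing Implicit Defensive.

Import Order.TTheory GRing.Theory Num.Theory.
Import passmx.
Local Open Scope ring_scope.

Lemma linfun_ext (C : fieldType) (U V : vectType C) (f : U -> V) :
  linear f -> linfun f =1 f.
Proof.
move=> lf.
pose aM := GRing.isSemilinear.Build C U V _ f (GRing.semilinear_linear lf).
pose ff : {linear U -> V} := HB.pack f aM.
exact: (lfunE ff).
Qed.

(* Stated for a variable family W so that directv does not look inside W i. *)
Definition direct_family (C : fieldType) (V : vectType C) (I : finType)
    (W : I -> {vspace V}) : bool := directv (\sum_i W i).

Section FamilyDirect.
Variables (C : fieldType) (V : vectType C) (I : finType).
Variables (W : I -> {vspace V}) (Q : I -> 'End(V)).

Lemma directv_proj :
  (forall i w, w \in W i -> Q i w = w) ->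
  (forall i j w, i != j -> w \in W j -> Q i w = 0) ->
  direct_family W.
Proof.
move=> Q1 Q0; apply/directv_sum_independent => us Wus us0 i _.
have := congr1 (Q i) us0; rewrite linear0 linear_sum (bigD1 i) //=.
rewrite Q1 ?Wus // big1 ?addr0 // => j ji.
by rewrite (Q0 i j) ?Wus // eq_sym.
Qed.
End FamilyDirect.

(* The grading is internal: yd_gr U x is the subspace U_x of the total space,
   and yd_act U g is L^U_g. *)
Record ydObj (C : fieldType) (gT : finGroupType) := YDObj {
  yd_space :> vectType C;
  yd_gr : gT -> {vspace yd_space};
  yd_act : gT -> 'End(yd_space);
  yd_direct : direct_family yd_gr;
  yd_full : (\sum_x yd_gr x)%VS = fullv;
  yd_act1 : yd_act 1%g = \1%VF;
  yd_actM : forall g h, yd_act (g * h)%g = (yd_act g \o yd_act h)%VF;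
  yd_act_gr : forall g x, (yd_act g @: yd_gr x)%VS = yd_gr (g * x * g^-1)%g
}.

Arguments yd_gr {C gT} _ _.
Arguments yd_act {C gT} _ _.

Lemma act_gr_eq (C : fieldType) (gT : finGroupType) (V : vectType C)
    (gr : gT -> {vspace V}) (act : gT -> 'End(V)) :
  act 1%g = \1%VF -> (forall g h, act (g * h)%g = (act g \o act h)%VF) ->
  (forall g x v, v \in gr x -> act g v \in gr (g * x * g^-1)%g) ->
  forall g x, (act g @: gr x)%VS = gr (g * x * g^-1)%g.
Proof.
move=> a1 aM sub g x; apply: subv_anti; apply/andP; split.
  by apply/subvP => _ /memv_imgP[v vx ->]; apply: sub.
apply/subvP => v vx; apply/memv_imgP; exists (act g^-1%g v).
  by have := sub g^-1%g _ _ vx; rewrite invgK !mulgA mulVg mul1g mulgKV.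
by rewrite -comp_lfunE -aM mulgV a1 id_lfunE.
Qed.

Section Category.
Variables (C : fieldType) (gT : finGroupType).
Implicit Types U V W X Y : ydObj C gT.

Definition is_ydmor U V (f : 'Hom(U, V)) : Prop :=
  (forall x, (f @: yd_gr U x <= yd_gr V x)%VS) /\
  (forall g, (f \o yd_act U g)%VF = (yd_act V g \o f)%VF).

Definition is_ydiso U V (f : 'Hom(U, V)) : Prop :=
  is_ydmor f /\
  exists2 f' : 'Hom(V, U), is_ydmor f' &
    (f' \o f)%VF = \1%VF /\ (f \o f')%VF = \1%VF.

(* The projection of U onto U_x along the other homogeneous components. *)
Definition yd_proj U (x : gT) : 'End(U) :=
  sumv_pi (\sum_x yd_gr U x)%VS x.

Lemma yd_proj_gr U x u : yd_proj U x u \in yd_gr U x.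
Proof. exact: memv_sum_pi. Qed.

Lemma yd_proj_sum U u : \sum_x yd_proj U x u = u.
Proof. by apply: sumv_pi_sum; rewrite yd_full memvf. Qed.

Lemma yd_projE U x y u :
  u \in yd_gr U y -> yd_proj U x u = if x == y then u else 0.
Proof.
move=> uy; have /directv_sum_unique H := yd_direct U.
have := H (fun x => yd_proj U x u) (fun x => if x == y then u else 0).
rewrite yd_proj_sum -big_mkcond big_pred1_eq eqxx => Hu.
apply/eqP; move: Hu => /(_ _ _)/esym/forallP; apply => //= i _.
  exact: yd_proj_gr.
by case: eqP => [->|] //; rewrite mem0v.
Qed.

(* The tensor product of two vector spaces, in coordinates: u (x) v is the
   outer product of the coordinate vectors of u and v. *)
Section Tensor.
Local Notation bas U := (vbasis (fullv : {vspace U})).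
Implicit Types A B D E : vectType C.

Definition tensor A B : vectType C :=
  'M[C]_(\dim (fullv : {vspace A}), \dim (fullv : {vspace B})).

Definition tens A B (a : A) (b : B) : tensor A B :=
  (rVof (bas A) a)^T *m rVof (bas B) b.

Definition tensf A B D E (f : 'Hom(A, D)) (g : 'Hom(B, E)) :
    'Hom(tensor A B, tensor D E) :=
  linfun (fun M : tensor A B =>
    ((mxof (bas A) (bas D) f)^T *m M *m mxof (bas B) (bas E) g
      : tensor D E)).

Definition tenswap A B : 'Hom(tensor A B, tensor B A) :=
  linfun (fun M : tensor A B => (M^T : tensor B A)).

Definition tensv A B (S : {vspace A}) (T : {vspace B}) :
    {vspace tensor A B} :=
  <<[seq tens a b | a <- vbasis S, b <- vbasis T]>>%VS.

Lemma tens_linear_l A B (b : B) : linear (fun a : A => tens a b).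
Proof. by move=> k x y; rewrite /tens !linearP /= mulmxDl -scalemxAl. Qed.

Lemma tens_linear_r A B (a : A) : linear (fun b : B => tens a b).
Proof. by move=> k x y; rewrite /tens !linearP. Qed.

Lemma tens_suml A B (b : B) J (r : seq J) (P : pred J) (F : J -> A) :
  tens (\sum_(j <- r | P j) F j) b = \sum_(j <- r | P j) tens (F j) b.
Proof.
have E := linfun_ext (@tens_linear_l A B b).
by rewrite -E linear_sum; apply: eq_bigr => j _ /=; rewrite E.
Qed.

Lemma tens_sumr A B (a : A) J (r : seq J) (P : pred J) (F : J -> B) :
  tens a (\sum_(j <- r | P j) F j) = \sum_(j <- r | P j) tens a (F j).
Proof.
have E := linfun_ext (@tens_linear_r A B a).
by rewrite -E linear_sum; apply: eq_bigr => j _ /=; rewrite E.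
Qed.

Lemma tens_scalel A B k (a : A) (b : B) : tens (k *: a) b = k *: tens a b.
Proof.
by have E := linfun_ext (@tens_linear_l A B b); rewrite -E linearZ /= E.
Qed.

Lemma tens_scaler A B k (a : A) (b : B) : tens a (k *: b) = k *: tens a b.
Proof.
by have E := linfun_ext (@tens_linear_r A B a); rewrite -E linearZ /= E.
Qed.

Lemma tens0l A B (b : B) : tens (0 : A) b = 0.
Proof. by rewrite -(scale0r (0 : A)) tens_scalel scale0r. Qed.

Lemma tens0r A B (a : A) : tens a (0 : B) = 0.
Proof. by rewrite -(scale0r (0 : B)) tens_scaler scale0r. Qed.

Lemma tenswapE A B (a : A) (b : B) : tenswap A B (tens a b) = tens b a.
Proof.
rewrite /tenswap linfun_ext; last by move=> k x y; rewrite linearP.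
by rewrite /tens trmx_mul trmxK.
Qed.

Lemma tensfE A B D E (f : 'Hom(A, D)) (g : 'Hom(B, E)) a b :
  tensf f g (tens a b) = tens (f a) (g b).
Proof.
rewrite /tensf linfun_ext; last first.
  by move=> k x y; rewrite mulmxDr mulmxDl -scalemxAr -scalemxAl.
rewrite /tens !(rVof_app _ (vbasisP _)) /=.
by rewrite trmx_mul !mulmxA.
Qed.

Lemma tensor_sum A B (M : tensor A B) :
  exists c : 'I_(\dim (fullv : {vspace A})) ->
             'I_(\dim (fullv : {vspace B})) -> C,
  M = \sum_i \sum_j c i j *: tens (bas A)`_i (bas B)`_j.
Proof.
exists (fun i j => (M : 'M_(_, _)) i j); rewrite {1}[M]matrix_sum_delta.
apply: eq_bigr => i _; apply: eq_bigr => j _; congr (_ *: _).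
by rewrite /tens !(rVofE (vbasisP _)) trmx_delta mul_delta_mx.
Qed.

Lemma tensor_ext A B D (f g : 'Hom(tensor A B, D)) :
  (forall a b, f (tens a b) = g (tens a b)) -> f = g.
Proof.
move=> fg; apply/lfunP => M; have [c ->] := tensor_sum M.
rewrite !linear_sum; apply: eq_bigr => i _; rewrite !linear_sum.
by apply: eq_bigr => j _; rewrite !linearZ /= fg.
Qed.

Lemma mem_tensv A B (S : {vspace A}) (T : {vspace B}) a b :
  a \in S -> b \in T -> tens a b \in tensv S T.
Proof.
move=> aS bT; rewrite (coord_vbasis aS) (coord_vbasis bT).
rewrite tens_suml rpred_sum // => i _; rewrite tens_scalel rpredZ //.
rewrite tens_sumr rpred_sum // => j _; rewrite tens_scaler rpredZ //.
apply: memv_span; apply/allpairsP.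
by exists ((vbasis S)`_i, (vbasis T)`_j); rewrite !mem_nth ?size_tuple.
Qed.

Lemma tensv_sub A B (S : {vspace A}) (T : {vspace B}) (W : {vspace _}) :
  (forall a b, a \in S -> b \in T -> tens a b \in W) -> (tensv S T <= W)%VS.
Proof.
move=> H; apply/span_subvP => _ /allpairsP[[a b] /= [aS bT ->]].
by apply: H; apply: vbasis_mem.
Qed.

End Tensor.

Section TensorObj.
Variables U V : ydObj C gT.

Definition tensor_gr (x : gT) : {vspace tensor U V} :=
  (\sum_(yz : gT * gT | (yz.1 * yz.2 == x)%g)
     tensv (yd_gr U yz.1) (yd_gr V yz.2))%VS.

Definition tensor_act (g : gT) : 'End(tensor U V) :=
  tensf (yd_act U g) (yd_act V g).

Lemma mem_tensor_gr y z u v :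
  u \in yd_gr U y -> v \in yd_gr V z -> tens u v \in tensor_gr (y * z)%g.
Proof.
move=> uy vz; rewrite memvE.
apply: (sumv_sup (y, z)) => //=.
by rewrite -memvE; apply: mem_tensv.
Qed.

Lemma tensor_gr_sub x (W : {vspace tensor U V}) :
  (forall y z u v, (y * z)%g = x -> u \in yd_gr U y -> v \in yd_gr V z ->
     tens u v \in W) -> (tensor_gr x <= W)%VS.
Proof.
move=> H; apply/subv_sumP => -[y z] /= /eqP yz.
by apply: tensv_sub => u v uy vz; apply: (H y z).
Qed.

Let Q x : 'End(tensor U V) :=
  \sum_(yz : gT * gT | (yz.1 * yz.2 == x)%g)
    tensf (yd_proj U yz.1) (yd_proj V yz.2).

Let QE x y z u v : u \in yd_gr U y -> v \in yd_gr V z ->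
  Q x (tens u v) = if (y * z)%g == x then tens u v else 0.
Proof.
move=> uy vz; rewrite /Q sum_lfunE big_mkcond (bigD1 (y, z)) //=.
rewrite tensfE (yd_projE _ uy) (yd_projE _ vz) !eqxx big1 ?addr0 //.
case=> y' z' /=; rewrite xpair_eqE negb_and => neq; case: ifP => // _.
rewrite tensfE (yd_projE _ uy) (yd_projE _ vz).
case: eqP neq => [_ /= /negPf ->|_ _].
  by rewrite tens0r.
by rewrite tens0l.
Qed.

Lemma tensor_direct : direct_family tensor_gr.
Proof.
apply: (@directv_proj _ _ _ tensor_gr Q) => [x w wx|x x' w xx' wx].
  rewrite -[RHS]id_lfunE; apply/eqlfunP; apply: subvP wx.
  apply: tensor_gr_sub => y z u v yz uy vz.
  by apply/eqlfunP; rewrite id_lfunE (QE _ uy vz) yz eqxx.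
apply/eqP; rewrite -memv_ker; apply: subvP wx; apply: tensor_gr_sub.
move=> y z u v yz uy vz.
by rewrite memv_ker (QE _ uy vz) yz [x' == x]eq_sym (negPf xx').
Qed.

Lemma tensor_full : (\sum_x tensor_gr x)%VS = fullv.
Proof.
apply/eqP; rewrite eqEsubv subvf /=; apply/subvP => M _.
have [c ->] := tensor_sum M.
apply: rpred_sum => i _; apply: rpred_sum => j _; apply: rpredZ.
rewrite -[X in tens X _]yd_proj_sum -[X in tens _ X]yd_proj_sum.
rewrite tens_suml rpred_sum // => y _.
rewrite tens_sumr rpred_sum // => z _.
rewrite memvE; apply: (sumv_sup (y * z)%g) => //.
by rewrite -memvE; apply: mem_tensor_gr; apply: yd_proj_gr.
Qed.

Lemma tensor_act1 : tensor_act 1%g = \1%VF.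
Proof. by apply: tensor_ext => u v; rewrite tensfE !yd_act1 !id_lfunE. Qed.

Lemma tensor_actM g h : tensor_act (g * h)%g = (tensor_act g \o tensor_act h)%VF.
Proof.
by apply: tensor_ext => u v; rewrite comp_lfunE !tensfE !yd_actM !comp_lfunE.
Qed.

Lemma tensor_act_gr g x :
  (tensor_act g @: tensor_gr x)%VS = tensor_gr (g * x * g^-1)%g.
Proof.
apply: act_gr_eq => {g x}[||g x w wx]; first exact: tensor_act1.
  exact: tensor_actM.
rewrite memv_preim; apply: subvP wx; apply: tensor_gr_sub.
move=> y z u v <- uy vz; rewrite -memv_preim tensfE.
have -> : (g * (y * z) * g^-1 = (g * y * g^-1) * (g * z * g^-1))%g.
  by rewrite !mulgA mulgKV.
by apply: mem_tensor_gr; rewrite -yd_act_gr memv_img.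
Qed.

Definition tensorObj : ydObj C gT :=
  YDObj tensor_direct tensor_full tensor_act1 tensor_actM tensor_act_gr.

(* u (x) v as an element of the tensor product object *)
Definition ydtens (u : U) (v : V) : tensorObj := tens u v.

End TensorObj.

(* On a summand U_x (x) V only the x-th term is nonzero; see braidingE. *)
Definition braiding U V : 'Hom(tensorObj U V, tensorObj V U) :=
  \sum_(x : gT) (tenswap U V \o tensf (yd_proj U x) (yd_act V x))%VF.

Lemma braidingE U V x u v : u \in yd_gr U x ->
  braiding U V (tens u v) = tens (yd_act V x v) u.
Proof.
move=> ux; rewrite /braiding sum_lfunE (bigD1 x) //= big1 ?addr0.
  by rewrite comp_lfunE tensfE tenswapE (yd_projE _ ux) eqxx.
move=> y yx; rewrite comp_lfunE tensfE tenswapE (yd_projE _ ux) (negPf yx).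
by rewrite tens0r.
Qed.

Section ClassPart.
Variables (X : ydObj C gT) (x : gT).

Definition class_vs : {vspace X} :=
  (\sum_(y in (x ^: [set: gT])%g) yd_gr X y)%VS.

Local Notation S := (subvs_of class_vs).

Definition class_gr (y : gT) : {vspace S} :=
  (linfun (vsval : S -> X) @^-1: yd_gr X y)%VS.

Definition class_act (g : gT) : 'End(S) :=
  linfun (fun u : S => vsproj class_vs (yd_act X g (vsval u))).

Lemma mem_class_gr y (u : S) : (u \in class_gr y) = (vsval u \in yd_gr X y).
Proof. by rewrite /class_gr -memv_preim lfunE. Qed.

Lemma class_vs_proj (u : X) :
  (forall y, y \notin (x ^: [set: gT])%g -> yd_proj X y u = 0) <->
  u \in class_vs.
Proof.
split=> [H|/memv_sumP[us Xus ->] y yx].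
  rewrite -(yd_proj_sum u) (bigID (mem (x ^: [set: gT])%g)) /=.
  rewrite [X in _ + X]big1 ?addr0 => [|y /H //].
  by apply: memv_sumr => y _; apply: yd_proj_gr.
rewrite linear_sum /= big1 // => z zx; rewrite (yd_projE _ (Xus z zx)).
by case: eqP => // yz; rewrite yz zx in yx.
Qed.

Lemma class_vs_gr y (u : X) :
  y \in (x ^: [set: gT])%g -> u \in yd_gr X y -> u \in class_vs.
Proof. by move=> yx uy; rewrite memvE; apply: (sumv_sup y); rewrite // -memvE. Qed.

Lemma class_vs_act g (u : X) : u \in class_vs -> yd_act X g u \in class_vs.
Proof.
move=> /memv_sumP[us Xus ->]; rewrite linear_sum rpred_sum //= => y yx.
apply: (@class_vs_gr (g * y * g^-1)%g); last by rewrite -yd_act_gr memv_img ?Xus.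
case/imsetP: yx => h _ ->.
have -> : (g * x ^ h * g^-1 = x ^ (h * g^-1))%g.
  by rewrite conjgM /conjg invgK !mulgA.
by rewrite memJ_class ?inE.
Qed.

Lemma class_actE g u : vsval (class_act g u) = yd_act X g (vsval u).
Proof.
rewrite /class_act linfun_ext; last by move=> k a b; rewrite !linearP.
by rewrite vsprojK // class_vs_act // subvsP.
Qed.

Lemma class_direct : direct_family class_gr.
Proof.
apply/directv_sum_independent => us Sus us0 y _; apply: val_inj => /=.
have /directv_sum_independent H := yd_direct X.
apply: (H (fun z => vsval (us z))) => // [z _|].
  by rewrite -mem_class_gr Sus.
by rewrite -linear_sum us0.
Qed.

Lemma class_full : (\sum_y class_gr y)%VS = fullv.
Proof.
apply/eqP; rewrite eqEsubv subvf /=; apply/subvP => u _.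
have pS y : yd_proj X y (vsval u) \in class_vs.
  have [yx|yx] := boolP (y \in (x ^: [set: gT])%g).
    by apply: (class_vs_gr yx); apply: yd_proj_gr.
  by have /class_vs_proj-> := subvsP u; rewrite ?mem0v.
have -> : u = \sum_y vsproj class_vs (yd_proj X y (vsval u)).
  rewrite -linear_sum yd_proj_sum; exact/esym/vsvalK.
by apply: memv_sumr => y _; rewrite mem_class_gr vsprojK // yd_proj_gr.
Qed.

Lemma class_act1 : class_act 1%g = \1%VF.
Proof.
by apply/lfunP => u; apply: subvs_inj; rewrite class_actE yd_act1 !id_lfunE.
Qed.

Lemma class_actM g h : class_act (g * h)%g = (class_act g \o class_act h)%VF.
Proof.
apply/lfunP => u; apply: subvs_inj.
by rewrite comp_lfunE !class_actE yd_actM comp_lfunE.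
Qed.

Lemma class_act_gr g y :
  (class_act g @: class_gr y)%VS = class_gr (g * y * g^-1)%g.
Proof.
apply: act_gr_eq => {g y}[||g y w]; first exact: class_act1.
  exact: class_actM.
by rewrite !mem_class_gr class_actE -yd_act_gr; apply: memv_img.
Qed.

Definition classObj : ydObj C gT :=
  YDObj class_direct class_full class_act1 class_actM class_act_gr.

(* Inverse to the inclusion of X_[x] in X on the elements of X_[x]. *)
Definition to_class (u : X) : classObj := vsproj class_vs u.

End ClassPart.

Definition class_restr X Y (x : gT) (f : 'Hom(X, Y)) :
    'Hom(classObj X x, classObj Y x) :=
  linfun (fun u : classObj X x =>
    to_class x (f (vsval (u : subvs_of (class_vs X x))))).

Lemma class_restrE X Y (x : gT) (f : 'Hom(X, Y)) (u : classObj X x) :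
  is_ydmor f ->
  vsval (class_restr x f u : subvs_of (class_vs Y x)) =
  f (vsval (u : subvs_of (class_vs X x))).
Proof.
case=> f_gr _; rewrite /class_restr linfun_ext; last first.
  by move=> a v w; rewrite /to_class !linearP.
rewrite /to_class vsprojK //.
have /memv_sumP[us Xus ->] := subvsP (u : subvs_of (class_vs X x)).
rewrite linear_sum rpred_sum //= => y yx; apply: (class_vs_gr yx).
by apply: (subvP (f_gr y)); rewrite memv_img ?Xus.
Qed.

End Category.

Section DirectSumSpace.
Variables (C : fieldType) (I : finType) (V : I -> vectType C).

Definition dsum : Type := {dffun forall i, V i}.

HB.instance Definition _ := Choice.on dsum.

Definition dsum_zero : dsum := [ffun i => 0].
Definition dsum_opp (f : dsum) : dsum := [ffun i => - f i].
Definition dsum_add (f g : dsum) : dsum := [ffun i => f i + g i].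
Definition dsum_scale (a : C) (f : dsum) : dsum := [ffun i => a *: f i].

Fact dsum_addA : associative dsum_add.
Proof. by move=> f g h; apply/ffunP => i; rewrite !ffunE addrA. Qed.
Fact dsum_addC : commutative dsum_add.
Proof. by move=> f g; apply/ffunP => i; rewrite !ffunE addrC. Qed.
Fact dsum_add0 : left_id dsum_zero dsum_add.
Proof. by move=> f; apply/ffunP => i; rewrite !ffunE add0r. Qed.
Fact dsum_addN : left_inverse dsum_zero dsum_opp dsum_add.
Proof. by move=> f; apply/ffunP => i; rewrite !ffunE addNr. Qed.

HB.instance Definition _ :=
  GRing.isZmodule.Build dsum dsum_addA dsum_addC dsum_add0 dsum_addN.

Fact dsum_scaleA a b f :
  dsum_scale a (dsum_scale b f) = dsum_scale (a * b) f.
Proof. by apply/ffunP => i; rewrite !ffunE scalerA. Qed.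
Fact dsum_scale1 : left_id 1 dsum_scale.
Proof. by move=> f; apply/ffunP => i; rewrite !ffunE scale1r. Qed.
Fact dsum_scaleDr : right_distributive dsum_scale +%R.
Proof. by move=> a f g; apply/ffunP => i; rewrite !ffunE scalerDr. Qed.
Fact dsum_scaleDl f : {morph dsum_scale^~ f : a b / a + b}.
Proof. by move=> a b; apply/ffunP => i; rewrite !ffunE scalerDl. Qed.

HB.instance Definition _ := GRing.Zmodule_isLmodule.Build C dsum
  dsum_scaleA dsum_scale1 dsum_scaleDr dsum_scaleDl.

Lemma dsumD (f g : dsum) i : (f + g) i = f i + g i.
Proof. by rewrite ffunE. Qed.
Lemma dsumZ a (f : dsum) i : (a *: f) i = a *: f i.
Proof. by rewrite ffunE. Qed.
Lemma dsum0 i : (0 : dsum) i = 0.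
Proof. by rewrite ffunE. Qed.
Lemma dsum_sum J (r : seq J) (P : pred J) (F : J -> dsum) i :
  (\sum_(j <- r | P j) F j) i = \sum_(j <- r | P j) F j i.
Proof.
by apply: (big_morph (fun f : dsum => f i)) => [f g|]; rewrite ?dsumD ?dsum0.
Qed.

Local Notation K i := 'I_(\dim (fullv : {vspace V i})).

Fact dsum_vect_iso : Vector.axiom #|{: {i : I & K i}}| dsum.
Proof.
exists (fun f : dsum => \row_j
  (rVof (vbasis fullv) (f (tag (enum_val j)))) 0 (tagged (enum_val j))).
  by move=> a f g; apply/rowP => j; rewrite !mxE dsumD dsumZ linearP.
exists (fun w : 'rV_ _ => [ffun i : I =>
  vecof (vbasis fullv) (\row_k w 0 (enum_rank (Tagged (fun i => K i) k)))
  : V i] : dsum).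
  move=> f; apply/ffunP => i; rewrite ffunE.
  rewrite -[RHS](rVofK (vbasisP _)); congr (vecof _ _).
  by apply/rowP => k; rewrite mxE mxE enum_rankK.
move=> w; apply/rowP => j; rewrite mxE ffunE (vecofK (vbasisP _)) mxE.
by congr (w 0 _); rewrite -[RHS]enum_valK; case: (enum_val j).
Qed.

HB.instance Definition _ := Lmodule_hasFinDim.Build C dsum dsum_vect_iso.

End DirectSumSpace.

Section DirectSum.
Variables (C : fieldType) (gT : finGroupType) (I : finType).
Variable V : I -> ydObj C gT.

Local Notation dsum_space := (dsum (fun i : I => yd_space (V i))).

Definition dsum_proj i : 'Hom(dsum_space, V i) :=
  linfun (fun f : dsum_space => f i).

Definition dsum_gr (x : gT) : {vspace dsum_space} :=
  (\bigcap_i (dsum_proj i @^-1: yd_gr (V i) x))%VS.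

Definition dsum_act (g : gT) : 'End(dsum_space) :=
  linfun (fun f : dsum_space => [ffun i => yd_act (V i) g (f i)] : dsum_space).

Lemma dsum_projE i f : dsum_proj i f = f i.
Proof. by rewrite /dsum_proj linfun_ext // => a u v /=; rewrite dsumD dsumZ. Qed.

Lemma dsum_actE g f i : dsum_act g f i = yd_act (V i) g (f i).
Proof.
rewrite /dsum_act linfun_ext ?ffunE // => a u v.
by apply/ffunP => j; rewrite dsumD dsumZ /= !ffunE linearP.
Qed.

Lemma mem_dsum_gr x (f : dsum_space) :
  reflect (forall i, f i \in yd_gr (V i) x) (f \in dsum_gr x).
Proof.
rewrite /dsum_gr memvE; apply: (iffP subv_bigcapP) => [H i|H i _].
  by have := H i isT; rewrite -memvE -memv_preim dsum_projE.
by rewrite -memvE -memv_preim dsum_projE; apply: H.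
Qed.

Lemma dsum_direct : direct_family dsum_gr.
Proof.
apply/directv_sum_independent => us Sus us0 x _; apply/ffunP => i.
rewrite dsum0; have /directv_sum_independent H := yd_direct (V i).
apply: (H (fun y => us y i)) => // [y _|].
  by have /mem_dsum_gr := Sus y isT.
by rewrite -dsum_sum us0 dsum0.
Qed.

Lemma dsum_full : (\sum_x dsum_gr x)%VS = fullv.
Proof.
apply/eqP; rewrite eqEsubv subvf /=; apply/subvP => f _.
have -> : f = \sum_x ([ffun i => yd_proj (V i) x (f i)] : dsum_space).
  apply/ffunP => i; rewrite dsum_sum -[LHS]yd_proj_sum.
  by apply: eq_bigr => x _; rewrite ffunE.
apply: memv_sumr => x _; apply/mem_dsum_gr => i; rewrite ffunE.
exact: yd_proj_gr.
Qed.

Lemma dsum_act1 : dsum_act 1%g = \1%VF.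
Proof.
by apply/lfunP => f; apply/ffunP => i; rewrite dsum_actE yd_act1 !id_lfunE.
Qed.

Lemma dsum_actM g h : dsum_act (g * h)%g = (dsum_act g \o dsum_act h)%VF.
Proof.
apply/lfunP => f; apply/ffunP => i.
by rewrite comp_lfunE !dsum_actE yd_actM comp_lfunE.
Qed.

Lemma dsum_act_gr g x :
  (dsum_act g @: dsum_gr x)%VS = dsum_gr (g * x * g^-1)%g.
Proof.
apply: act_gr_eq => {g x}[||g x f /mem_dsum_gr fx]; first exact: dsum_act1.
  exact: dsum_actM.
by apply/mem_dsum_gr => i; rewrite dsum_actE -yd_act_gr memv_img.
Qed.

Definition dsumObj : ydObj C gT :=
  YDObj dsum_direct dsum_full dsum_act1 dsum_actM dsum_act_gr.

End DirectSum.

Record coset_reps (gT : finGroupType) (x : gT) := CosetReps {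
  reps_set :> {set gT};
  reps_trans : is_transversal reps_set (lcosets 'C[x]%g [set: gT]) [set: gT]
}.

Section Induced.
Variables (C : fieldType) (gT : finGroupType) (x : gT) (Rx : coset_reps x).

Definition class_of := {y : gT | y \in (x ^: [set: gT])%g}.

(* The representative a in R_x with a x a^-1 = y. *)
Definition class_rep (y : gT) : gT :=
  odflt 1%g [pick a in reps_set Rx | (a * x * a^-1)%g == y].

Lemma class_rep_exists (y : class_of) :
  exists2 a, a \in reps_set Rx & (a * x * a^-1)%g = val y.
Proof.
case: y => y /= /imsetP[g _ ->].
have gP : (g^-1 *: 'C[x])%g \in lcosets 'C[x]%g [set: gT].
  by apply/lcosetsP; exists g^-1%g; rewrite ?inE.
pose a := transversal_repr 1%g (reps_set Rx) (g^-1 *: 'C[x])%g.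
exists a; first exact: (repr_mem_transversal (reps_trans Rx)).
have : a \in (g^-1 *: 'C[x])%g by apply: (repr_mem_pblock (reps_trans Rx)).
case/lcosetP => c /cent1P cx ->.
rewrite invMg invgK /conjg !mulgA; congr (_ * _)%g.
by rewrite -!mulgA; congr (_ * _)%g; rewrite mulgA cx mulgK.
Qed.

Lemma class_repP (y : class_of) :
  (class_rep (val y) * x * (class_rep (val y))^-1)%g = val y.
Proof.
rewrite /class_rep; case: pickP => [a /andP[_ /eqP]//|no].
by have [a aR /eqP ay] := class_rep_exists y; have := no a; rewrite aR ay.
Qed.

Lemma conj_classP (y : class_of) g : (val y ^ g)%g \in (x ^: [set: gT])%g.
Proof.
case: y => y /= /imsetP[h _ ->]; by rewrite -conjgM memJ_class ?inE.
Qed.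

Definition conj_class (y : class_of) g : class_of :=
  @exist gT (fun z => z \in (x ^: [set: gT])%g) (val y ^ g)%g (conj_classP y g).

Variables (n : nat) (rho : mx_representation C 'C[x] n).

(* U(rho) is the space of column vectors, on which b in Cen(x) acts by rho b.
   An element of U(x, rho) is the family of its components in U(rho), indexed
   by the conjugacy class of x. *)
Definition ind_space : vectType C := {ffun class_of -> 'cV[C]_n}.

Definition ind_vec (y : gT) (w : 'cV[C]_n) : ind_space :=
  [ffun z : class_of => if val z == y then w else 0].

Definition ind_gr (y : gT) : {vspace ind_space} :=
  lker (linfun (fun f : ind_space =>
    [ffun z : class_of => if val z == y then 0 else f z] : ind_space)).

(* The element b of Cen(x) with g a = a' b, where a' is the representative
   of y and a the one of g^-1 y g. *)
Definition ind_cocycle (g y : gT) : gT :=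
  ((class_rep y)^-1 * (g * class_rep (y ^ g)))%g.

Definition ind_act (g : gT) : 'End(ind_space) :=
  linfun (fun f : ind_space =>
    [ffun y : class_of =>
       rho (ind_cocycle g (val y)) *m f (conj_class y g)] : ind_space).

Lemma ind_cocycle_cent g (y : class_of) : ind_cocycle g (val y) \in 'C[x]%g.
Proof.
have /= Ha := class_repP (conj_class y g); have Ha' := class_repP y.
rewrite /ind_cocycle; set a := class_rep _ in Ha *; set a' := class_rep _ in Ha' *.
have ax : (a * x = val y ^ g * a)%g by rewrite -Ha mulgKV.
have xa : (a'^-1 * val y = x * a'^-1)%g by rewrite -Ha' !mulgA mulVg mul1g.
apply/cent1P; rewrite /commute -!mulgA -/a -/a' ax conjgE !mulgA.
by rewrite mulgK xa.
Qed.

Lemma mem_ind_gr y (f : ind_space) :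
  reflect (forall z : class_of, val z != y -> f z = 0) (f \in ind_gr y).
Proof.
rewrite /ind_gr memv_ker linfun_ext; last first.
  move=> a u v; apply/ffunP => z; rewrite !ffunE.
  by case: eqP; rewrite ?scaler0 ?addr0.
apply: (iffP eqP) => [/ffunP H z zy|H].
  by have := H z; rewrite !ffunE (negPf zy).
by apply/ffunP => z; rewrite !ffunE; case: ifPn => // /H.
Qed.

Lemma ind_actE g f y :
  ind_act g f y = rho (ind_cocycle g (val y)) *m f (conj_class y g).
Proof.
rewrite /ind_act linfun_ext ?ffunE // => a u v.
by apply/ffunP => z; rewrite !ffunE mulmxDr scalemxAr.
Qed.

Lemma ind_direct : direct_family ind_gr.
Proof.
apply/directv_sum_independent => us Sus us0 y _; apply/ffunP => z.
rewrite ffunE; have [zy|zy] := eqVneq (val z) y; last first.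
  by have /mem_ind_gr -> := Sus y isT.
have := congr1 (fun f : ind_space => f z) us0.
rewrite /= sum_ffunE (bigD1 y) //= big1 ?addr0 ?ffunE // => y' y'y.
have /mem_ind_gr -> // := Sus y' isT.
by rewrite zy eq_sym.
Qed.

Lemma ind_full : (\sum_y ind_gr y)%VS = fullv.
Proof.
apply/eqP; rewrite eqEsubv subvf /=; apply/subvP => f _.
have -> : f = \sum_y ([ffun z => if val z == y then f z else 0] : ind_space).
  apply/ffunP => z; rewrite sum_ffunE (bigD1 (val z)) //= ffunE eqxx.
  by rewrite big1 ?addr0 // => y yz; rewrite ffunE eq_sym (negPf yz).
apply: memv_sumr => y _; apply/mem_ind_gr => z zy.
by rewrite ffunE (negPf zy).
Qed.

Lemma ind_act1 : ind_act 1%g = \1%VF.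
Proof.
apply/lfunP => f; apply/ffunP => y; rewrite ind_actE id_lfunE /ind_cocycle.
rewrite conjg1 mul1g mulVg repr_mx1 mul1mx; congr (f _).
by apply: val_inj; rewrite /= conjg1.
Qed.

Lemma ind_actM g h : ind_act (g * h)%g = (ind_act g \o ind_act h)%VF.
Proof.
apply/lfunP => f; apply/ffunP => y; rewrite comp_lfunE !ind_actE.
rewrite mulmxA -repr_mxM ?ind_cocycle_cent //; congr (rho _ *m f _).
  by rewrite /ind_cocycle /= conjgM !mulgA mulgK.
by apply: val_inj; rewrite /= conjgM.
Qed.

Lemma ind_act_gr g y :
  (ind_act g @: ind_gr y)%VS = ind_gr (g * y * g^-1)%g.
Proof.
apply: act_gr_eq => {g y}[||g y f /mem_ind_gr fy]; first exact: ind_act1.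
  exact: ind_actM.
apply/mem_ind_gr => z zy; rewrite ind_actE fy ?mulmx0 //=.
apply: contra zy => /eqP <-.
by rewrite /conjg !mulgA mulgV mul1g mulgK.
Qed.

(* U(x, rho); rho is not assumed irreducible here, and is used below only in
   dimension one. *)
Definition indObj : ydObj C gT :=
  YDObj ind_direct ind_full ind_act1 ind_actM ind_act_gr.

(* The scalar attached to the object U(x, rho) *)
Definition theta : C := \tr (rho x).

End Induced.

Section SL2.
Variable F : finFieldType.

Definition SL2 := {M : 'M[F]_2 | \det M == 1}.

HB.instance Definition _ := Finite.on SL2.
HB.instance Definition _ := SubType.on SL2.

Fact SL2_oneP : \det (1%:M : 'M[F]_2) == 1.
Proof. by rewrite det1. Qed.
Fact SL2_mulP (M N : SL2) : \det (val M *m val N) == 1.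
Proof. by rewrite det_mulmx (eqP (valP M)) (eqP (valP N)) mulr1. Qed.
Fact SL2_invP (M : SL2) : \det (invmx (val M)) == 1.
Proof. by rewrite det_inv (eqP (valP M)) invr1. Qed.

Definition SL2_one : SL2 := Sub 1%:M SL2_oneP.
Definition SL2_mul (M N : SL2) : SL2 := Sub (val M *m val N) (SL2_mulP M N).
Definition SL2_inv (M : SL2) : SL2 := Sub (invmx (val M)) (SL2_invP M).

Fact SL2_mulA : associative SL2_mul.
Proof. by move=> L M N; apply: val_inj; rewrite /= mulmxA. Qed.
Fact SL2_mul1 : left_id SL2_one SL2_mul.
Proof. by move=> M; apply: val_inj; rewrite /= mul1mx. Qed.
Fact SL2_mulV : left_inverse SL2_one SL2_inv SL2_mul.
Proof.
move=> M; apply: val_inj; rewrite /= mulVmx //.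
by rewrite unitmxE (eqP (valP M)) unitr1.
Qed.

HB.instance Definition _ := Finite_isGroup.Build SL2 SL2_mulA SL2_mul1 SL2_mulV.

Definition bmat (y : F) : 'M[F]_2 :=
  \matrix_(i, j) (if i == j then 1 else if (i < j)%N then y else 0).

Lemma det22 (M : 'M[F]_2) : \det M = M 0 0 * M 1 1 - M 0 1 * M 1 0.
Proof.
rewrite (expand_det_row _ 0) !big_ord_recl big_ord0 addr0 /cofactor.
rewrite !det_mx11 !mxE /= expr0 mul1r expr1 mulN1r mulrN.
by congr (_ * M _ _ - M _ _ * M _ _); apply: val_inj.
Qed.

Fact mubP (mu : bool) (y : F) : \det ((-1) ^+ mu *: bmat y) == 1.
Proof.
rewrite detZ det22 !mxE /= mulr0 subr0 !mulr1 -exprM.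
by rewrite mulnC exprM sqrrN expr1n expr1n.
Qed.

(* The element mu b(y); a sign is a boolean s standing for (-1) ^+ s, so that
   the acute accent is the coercion from bool to nat. *)
Definition mub (mu : bool) (y : F) : SL2 :=
  Sub ((-1) ^+ mu *: bmat y) (mubP mu y).

Lemma mub00 mu y : val (mub mu y) 0 0 = (-1) ^+ mu.
Proof. by rewrite /= !mxE /= mulr1. Qed.
Lemma mub01 mu y : val (mub mu y) 0 1 = (-1) ^+ mu * y.
Proof. by rewrite /= !mxE. Qed.

End SL2.

Section Trace.
Variables (F : finFieldType) (p : nat) (chF : p \in [pchar F]).

(* The trace of F over its prime field, i.e. the trace of the multiplication
   by v as an 'F_p-linear endomorphism of F. *)
Definition trF (v : F) : 'F_p :=
  let L := pPrimeCharType chF in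
  \tr (mxof (vbasis {:L}) (vbasis {:L}) (amull (v : L))).

Lemma trFD : {morph trF : v w / v + w}.
Proof.
move=> v w; rewrite /trF /=.
by rewrite [amull _](raddfD (@amull _ (pPrimeCharType chF))) !linearD.
Qed.

Lemma trF0 : trF 0 = 0.
Proof. by apply: (addIr (trF 0)); rewrite -trFD !add0r. Qed.

End Trace.

(* exp(2 pi i / p) *)
Definition zeta (R : realType) (p : nat) : R[i] :=
  (cos (2 * pi / p%:R) +i* sin (2 * pi / p%:R))%C.

Lemma zetaX (R : realType) (p : nat) : (0 < p)%N -> zeta R p ^+ p = 1.
Proof.
move=> p0; pose t : R := 2 * pi / p%:R.
have H k : zeta R p ^+ k = (cos (t *+ k) +i* sin (t *+ k))%C.
  elim: k => [|k IH]; first by rewrite expr0 mulr0n cos0 sin0.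
  rewrite exprS IH /zeta -/t mulrS cosD sinD.
  by apply/eqP; rewrite eq_complex /= eqxx addrC eqxx.
rewrite H -mulr_natr /t mulfVK ?pnatr_eq0 -?lt0n //.
by rewrite mulr_natl cos2pi sin2pi.
Qed.

Section Bobjects.
Variables (R : realType) (F : finFieldType) (p : nat) (chF : p \in [pchar F]).

(* The value of (nu, v)^* at g = eta b(c): eta is the entry (0, 0) of g and
   eta * c its entry (0, 1), hence c = eta * (eta * c). *)
Definition nuv_char (nu : bool) (v : F) (g : SL2 F) : R[i] :=
  (if val g 0 0 == 1 then 1 else -1) ^+ nu
  * zeta R p ^+ trF chF (v * (val g 0 0 * val g 0 1)).

Lemma zeta_trD v w :
  zeta R p ^+ trF chF (v + w) = zeta R p ^+ trF chF v * zeta R p ^+ trF chF w.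
Proof.
have p_pr := pcharf_prime chF; have zp := zetaX R (prime_gt0 p_pr).
rewrite trFD -exprD /= -[RHS](expr_mod _ zp).
by congr (_ ^+ (_ %% _)); apply: Fp_cast.
Qed.

Lemma nuv_charE nu v mu c : odd p ->
  nuv_char nu v (mub mu c) = ((-1) ^+ mu) ^+ nu * zeta R p ^+ trF chF (v * c).
Proof.
move=> p_odd; rewrite /nuv_char mub00 mub01 [_ * (_ * c)]mulrA.
rewrite -expr2 sqrr_sign mul1r; congr (_ ^+ _ * _).
case: mu; rewrite ?eqxx // expr1; case: eqP => // /esym/eqP.
rewrite -subr_eq0 opprK -[1 + 1]/(2%:R) -(dvdn_pcharf chF).
by rewrite dvdn_prime2 ?(pcharf_prime chF) // => /eqP p2; rewrite p2 in p_odd.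
Qed.

Lemma SL2_cent mu (y : F) (g : SL2 F) : y != 0 -> g \in 'C[mub mu y]%g ->
  val g 1 0 = 0 /\ (val g 0 0 = 1 \/ val g 0 0 = -1) /\
  val g 1 1 = val g 0 0.
Proof.
move=> y0 /cent1P /(congr1 val) /=.
have s0 : (-1) ^+ mu != 0 :> F by rewrite signr_eq0.
rewrite -scalemxAl -scalemxAr => /(scalerI s0) E.
have := congr1 (fun M : 'M_2 => M 0 0) E; have := congr1 (fun M : 'M_2 => M 0 1) E.
have l1 : lift ord0 ord0 = 1 :> 'I_2 by apply: val_inj.
have o0 : ord0 = 0 :> 'I_2 by [].
rewrite !mxE !big_ord_recl !big_ord0 !mxE /= l1 o0 => E01 E00.
have g10 : val g 1 0 = 0.
  apply: (mulfI y0); rewrite mulr0.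
  by move: E00; rewrite mulr1 mulr0 !addr0 mul1r => /esym/(canRL (addKr _))->; rewrite addNr.
have g11 : val g 1 1 = val g 0 0.
  apply: (mulfI y0); move: E01; rewrite mulr1 mul1r !addr0 addrC.
  by move=> /addrI E1; rewrite [RHS]mulrC; apply: esym E1.
split=> //; split=> //.
have := eqP (valP g); rewrite det22 g10 g11 mulr0 subr0 -expr2 => /eqP.
by rewrite sqrf_eq1 => /orP[] /eqP; [left | right].
Qed.

Lemma nuv_char_repr nu v mu (y : F) : y != 0 ->
  mx_repr 'C[mub mu y]%g (fun g => (nuv_char nu v g)%:M : 'M[R[i]]_1).
Proof.
move=> y0; split=> [|g h gC hC].
  rewrite /nuv_char /= !mxE /= eqxx expr1n mul1r mulr0 mulr0.
  by rewrite trF0 expr0.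
have [g10 [g00 g11]] := SL2_cent y0 gC.
have [h10 [h00 h11]] := SL2_cent y0 hC.
rewrite -scalar_mxM; congr _%:M.
have l1 : lift ord0 ord0 = 1 :> 'I_2 by apply: val_inj.
have o0 : ord0 = 0 :> 'I_2 by [].
have E00 : val (g * h)%g 0 0 = val g 0 0 * val h 0 0.
  by rewrite /= mxE !big_ord_recl big_ord0 l1 o0 h10 mulr0 !addr0.
have E01 : val (g * h)%g 0 1 = val g 0 0 * val h 0 1 + val g 0 1 * val h 0 0.
  by rewrite /= mxE !big_ord_recl big_ord0 l1 o0 -h11 addr0.
have sq (a : F) : a = 1 \/ a = -1 -> a * a = 1.
  by case=> ->; rewrite ?mulr1 // mulrNN mulr1.
rewrite /nuv_char E00 E01.
have -> : v * (val g 0 0 * val h 0 0 *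
             (val g 0 0 * val h 0 1 + val g 0 1 * val h 0 0)) =
          v * (val g 0 0 * val g 0 1) + v * (val h 0 0 * val h 0 1).
  rewrite -mulrDr; congr (v * _); rewrite mulrDr addrC; congr (_ + _).
    by rewrite mulrACA (sq (val h 0 0)) // mulr1.
  by rewrite mulrACA (sq (val g 0 0)) // mul1r.
rewrite zeta_trD mulrACA -exprMn; congr (_ ^+ _ * _).
case: g00 => ->; case: h00 => ->; rewrite ?(mulr1, mul1r) ?eqxx ?mul1r //.
  by rewrite mulr1.
by rewrite mulrNN mulr1 eqxx; case: ifP => _; rewrite ?mulr1 // mulrNN mulr1.
Qed.

Definition nuv_repr (nu : bool) (v : F) (mu : bool) (y : F) (y0 : y != 0) :
    mx_representation R[i] 'C[mub mu y]%g 1 :=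
  MxRepresentation (nuv_char_repr nu v mu y0).

Variable e : {unit F}.
Variable reps : forall x : SL2 F, coset_reps x.

Lemma unit_exp_neq0 k : val e ^+ k != 0.
Proof. by rewrite expf_neq0 // -unitfE (valP e). Qed.

(* (nu, v)^* on Cen(mu b_eps), where b_eps = b(e^eps') *)
Definition nuv_at (mu eps nu : bool) (v : F) :=
  nuv_repr nu v mu (unit_exp_neq0 eps).

Definition Bobj (mu eps nu : bool) (v : F) : ydObj R[i] (SL2 F) :=
  indObj (reps (mub mu (val e ^+ eps))) (nuv_at mu eps nu v).

(* The basis vector of degree y *)
Definition Bvec (mu eps nu : bool) (v : F) (y : SL2 F) : Bobj mu eps nu v :=
  ind_vec (mub mu (val e ^+ eps)) y 1%:M.

(* The identity map between two of these objects having the same underlying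
   graded space; it is a morphism when v = v'. *)
Definition Bid (mu eps nu : bool) (v v' : F) :
    'Hom(Bobj mu eps nu v, Bobj mu eps nu v') := linfun id.

Lemma BidE mu eps nu v v' (f : Bobj mu eps nu v) :
  Bid mu eps nu v v' f = f.
Proof. by rewrite /Bid linfun_ext. Qed.

Variable h : nat.

Definition nzsquare (a : F) : bool :=
  [exists z : F, (z != 0) && (a == z ^+ 2)].

(* H', as a subset of [1, 2h] *)
Definition Hset (eps eps1 eps2 : bool) : {set 'I_(2 * h).+1} :=
  [set i : 'I_(2 * h).+1 | (0 < i)%N &&
    nzsquare ((val e ^+ eps - val e ^+ (2 * i + eps2)) * val e ^- eps1)].

(* The index \hat i in [1, 2h]; it exists and is unique for i in H'. *)
Definition hat (eps eps1 eps2 : bool) (i : 'I_(2 * h).+1) : 'I_(2 * h).+1 :=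
  odflt ord0 [pick j : 'I_(2 * h).+1 | (0 < j)%N &&
    (val e ^+ eps - val e ^+ (2 * i + eps2) == val e ^+ (2 * j + eps1))].

Definition Hidx (eps eps1 eps2 : bool) : finType :=
  {i : 'I_(2 * h).+1 | i \in Hset eps eps1 eps2}.

(* The parameter e^(-2 \hat d) v1 + e^(-2d) v2 of the summand of index d *)
Definition summand_v (eps eps1 : bool) (v1 : F) (eps2 : bool) (v2 : F)
    (d : 'I_(2 * h).+1) : F :=
  val e ^- (2 * hat eps eps1 eps2 d) * v1 + val e ^- (2 * d) * v2.

Definition Bsum (mu eps nu eps1 : bool) (v1 : F) (eps2 : bool) (v2 : F) :
    ydObj R[i] (SL2 F) :=
  dsumObj (fun d : Hidx eps eps1 eps2 =>
    Bobj mu eps nu (summand_v eps eps1 v1 eps2 v2 (val d))).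

(* phi is an isomorphism from the part of X1 (.) X2 supported on [mu b_eps] to
   the direct sum, with the prescribed values, where
   X_j = B^{nu_j,v_j}_{mu_j,eps_j}. *)
Definition is_decomposition (mu eps nu : bool)
    (mu1 eps1 nu1 : bool) (v1 : F) (mu2 eps2 nu2 : bool) (v2 : F)
    (phi : 'Hom(classObj (tensorObj (Bobj mu1 eps1 nu1 v1)
                                    (Bobj mu2 eps2 nu2 v2))
                         (mub mu (val e ^+ eps)),
                Bsum mu eps nu eps1 v1 eps2 v2)) : Prop :=
  is_ydiso phi /\
  forall i : Hidx eps eps1 eps2,
    let i' := hat eps eps1 eps2 (val i) in
    phi (to_class _
      (ydtens (Bvec mu1 eps1 nu1 v1 (mub mu1 (val e ^+ (2 * i' + eps1))))
              (Bvec mu2 eps2 nu2 v2 (mub mu2 (val e ^+ (2 * val i + eps2)))))) =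
    [ffun d : Hidx eps eps1 eps2 =>
       (d == i)%:R *: Bvec mu eps nu (summand_v eps eps1 v1 eps2 v2 (val d))
                        (mub mu (val e ^+ eps))].

(* The map \bigoplus_d c_d J(d, \hat d), from the decomposition of X1 (.) X2
   to that of X2 (.) X1: its component at d' is the sum of the c_d J(d, d')
   over the d with \hat d = d'. *)
Definition diag_map (mu eps nu eps1 : bool) (v1 : F) (eps2 : bool) (v2 : F)
    (c : Hidx eps eps1 eps2 -> R[i]) :
    'Hom(Bsum mu eps nu eps1 v1 eps2 v2, Bsum mu eps nu eps2 v2 eps1 v1) :=
  linfun (fun f : Bsum mu eps nu eps1 v1 eps2 v2 =>
    [ffun d' : Hidx eps eps2 eps1 =>
       \sum_(d | hat eps eps1 eps2 (val d) == val d')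
         c d *: Bid mu eps nu _ (summand_v eps eps2 v2 eps1 v1 (val d')) (f d)]
    : Bsum mu eps nu eps2 v2 eps1 v1).

Lemma diag_mapE mu eps nu eps1 v1 eps2 v2 c f (d' : Hidx eps eps2 eps1) :
  @diag_map mu eps nu eps1 v1 eps2 v2 c f d' =
  \sum_(d | hat eps eps1 eps2 (val d) == val d') c d *: Bid mu eps nu _ _ (f d).
Proof.
rewrite /diag_map linfun_ext ?ffunE // => a u w; apply/ffunP => i.
rewrite dsumD dsumZ !ffunE scaler_sumr -big_split; apply: eq_bigr => d _ /=.
by rewrite dsumD dsumZ linearP scalerDr !scalerA mulrC.
Qed.

End Bobjects.

Arguments hat {F} e {h} eps eps1 eps2 i.
Arguments summand_v {F} e {h} eps eps1 v1 eps2 v2 d.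
Arguments is_decomposition {R F p chF e reps h}
  mu eps nu mu1 eps1 nu1 v1 mu2 eps2 nu2 v2 phi.
Arguments diag_map {R F p} chF e reps {h} mu eps nu eps1 v1 eps2 v2 c.

(* Main.v *)
Require Import Defs.
From HB Require Import structures.
From mathcomp Require Import all_boot all_order all_algebra all_fingroup.
From mathcomp Require Import all_solvable all_field mxrepresentation.
From mathcomp Require Import complex reals trigo ring.

(** An object supported on the class of x is determined by its component at x
    as a representation of Cen(x). Write x = mu b_eps. If y1 y2 = x with y_j in
    the class of mu_j b_(eps_j), then comparing traces shows that the nilpotent
    parts of y1 and y2 have the same kernel as that of x, so y_j = mu_j b(c_j)
    with c_j in e^(eps_j) (F^x)^2 and c1 + c2 = e^eps: these pairs are indexed by H'.
    All of them are centralized by Cen(x), which therefore acts on each line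
    C y1 (x) y2 by a character, and conjugating by diag(k, 1/k) identifies that
    character. The braiding sends y1 (x) y2 to L_(y1)(y2) (x) y1, where y1 acts
    on y2 by a scalar for the same reason. Since Cen(b_eps) is abelian, none of
    these scalars depends on the choice of coset representatives. *)

Set Implicit Arguments.
Unset Strict Implicit.
Unset Printing Implicit Defensive.

Import Order.TTheory GRing.Theory Num.Theory.
Local Open Scope ring_scope.

(** * Functionals on a tensor product *)

Section TensorFunctional.
Variables (C : fieldType) (A B : vectType C).
Import passmx.
Local Notation bas U := (vbasis (fullv : {vspace U})).

(** The functional f (x) g; tensors being coordinate matrices, it is given by its values on the
    basis tensors. *)
Definition tens_fun (f : 'Hom(A, C^o)) (g : 'Hom(B, C^o)) :
    'Hom(tensor A B, C^o) :=
  linfun (fun M : tensor A B =>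
    \sum_i \sum_j (M : 'M_(_, _)) i j * (f (bas A)`_i * g (bas B)`_j) : C^o).

Lemma tens_funE f g a b : tens_fun f g (tens a b) = f a * g b.
Proof.
rewrite /tens_fun linfun_ext; last first.
  move=> k M N; rewrite scaler_sumr -big_split; apply: eq_bigr => i _ /=.
  rewrite scaler_sumr -big_split; apply: eq_bigr => j _ /=.
  by rewrite !mxE mulrDl -mulrA.
have E (V : vectType C) (l : 'Hom(V, C^o)) (v : V) :
    l v = \sum_i rVof (bas V) v 0 i * l (bas V)`_i.
  rewrite {1}(coord_vbasis (memvf v)) linear_sum; apply: eq_bigr => i _.
  by rewrite linearZ /= mxE.
rewrite (E _ f) (E _ g) mulr_suml; apply: eq_bigr => i _.
rewrite mulr_sumr; apply: eq_bigr => j _.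
by rewrite /tens mxE big_ord1 mxE mulrACA.
Qed.

End TensorFunctional.

(** * The braiding as a morphism *)

Lemma yd_actME (C : fieldType) (gT : finGroupType) (U : ydObj C gT)
    (g h : gT) (u : U) :
  yd_act U (g * h)%g u = yd_act U g (yd_act U h u).
Proof. by rewrite yd_actM comp_lfunE. Qed.

Lemma yd_proj_act (C : fieldType) (gT : finGroupType) (U : ydObj C gT)
    (g x : gT) (u : U) :
  yd_act U g (yd_proj U x u) = yd_proj U (g * x * g^-1)%g (yd_act U g u).
Proof.
have Hgr y : yd_act U g (yd_proj U y u) \in yd_gr U (g * y * g^-1)%g.
  by rewrite -yd_act_gr memv_img ?yd_proj_gr.
rewrite -[u in RHS]yd_proj_sum !linear_sum (bigD1 x) //= big1 ?addr0 => [|y yx].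
  by rewrite (yd_projE _ (Hgr x)) eqxx.
rewrite (yd_projE _ (Hgr y)) ifN //.
apply: contraNneq yx => /(congr1 (fun t => g^-1 * t * g)%g).
by rewrite !mulgA !mulVg !mul1g !mulgKV => ->.
Qed.

(** By linearity the left factor may be taken homogeneous, of degree x; the claim is then (g x g^-1)
    g = g x. *)
Lemma braiding_act (C : fieldType) (gT : finGroupType) (U V : ydObj C gT) g
    (M : tensorObj U V) :
  braiding U V (yd_act (tensorObj U V) g M) =
  yd_act (tensorObj V U) g (braiding U V M).
Proof.
rewrite -!comp_lfunE; congr (fun_of_lfun _ M); apply: tensor_ext => u v.
rewrite !comp_lfunE /= /tensor_act tensfE -(yd_proj_sum u) tens_suml !linear_sum.
rewrite tens_suml linear_sum; apply: eq_bigr => x _ /=.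
have ux := yd_proj_gr x u.
rewrite (braidingE v ux) (@braidingE _ _ _ _ (g * x * g^-1)%g); last first.
  by rewrite -yd_act_gr memv_img.
by rewrite tensfE -!yd_actME mulgKV.
Qed.

Lemma braiding_mor (C : fieldType) (gT : finGroupType) (U V : ydObj C gT) :
  is_ydmor (braiding U V).
Proof.
split=> [x|g]; last first.
  by apply/lfunP => M; rewrite !comp_lfunE braiding_act.
apply/subvP => _ /memv_imgP[M Mx ->].
rewrite memv_preim; apply: subvP Mx; apply: tensor_gr_sub.
move=> y z u v <- uy vz; rewrite -memv_preim (braidingE v uy).
(* L_y v has degree y z y^-1, so L_y v (x) u still has degree y z. *)
have -> : (y * z = (y * z * y^-1) * y)%g by rewrite mulgKV.
by apply: mem_tensor_gr; rewrite // -yd_act_gr memv_img.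
Qed.

(** * The class part of an object, rebuilt from its component at x *)

Section Isotypic.
Variables (C : fieldType) (gT : finGroupType) (X : ydObj C gT) (x : gT).
Variables (Rx : coset_reps x) (I : finType).
Variables (rho : I -> mx_representation C 'C[x]%g 1).
Variables (w : I -> X) (ell : I -> 'Hom(X, C^o)).

(* The w d form a basis of X_x on which Cen(x) acts by the characters rho d,
   and the ell d are its coordinate functions, extended by 0 to the other
   components of X. *)
Definition isotypic_basis : Prop :=
  [/\ forall d, w d \in yd_gr X x,
      forall d d', ell d (w d') = (d == d')%:R,
      forall u, u \in yd_gr X x -> u = \sum_d (ell d u : C) *: w d,
      forall d y u, y != x -> u \in yd_gr X y -> ell d u = 0 &
      forall d b u, b \in 'C[x]%g ->
        ell d (yd_act X b u) = rho d b 0 0 * ell d u].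

Local Notation a z := (class_rep Rx z).
Local Notation Y := (dsumObj (fun d => indObj Rx (rho d))).
Local Notation XX := (classObj X x).

(* The unique equivariant extension of the coordinates on X_x; the factor
   rho d (a x) accounts for a representative of x which need not be 1. *)
Definition isotypic_map : 'Hom(XX, Y) :=
  linfun (fun u : XX =>
    [ffun d => [ffun z : class_of x =>
       (rho d (a x) 0 0 * ell d (yd_act X (a (val z))^-1%g
          (vsval (u : subvs_of (class_vs X x)))))%:M]] : Y).

Lemma isotypic_mapE u d z :
  (isotypic_map u : dsum _) d z =
  (rho d (a x) 0 0 * ell d (yd_act X (a (val z))^-1%g (vsval u)))%:M.
Proof.
rewrite /isotypic_map linfun_ext ?ffunE // => k v1 v2.
apply/ffunP => i; apply/ffunP => y.
rewrite dsumD dsumZ !ffunE !linearP /=.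
by rewrite mulrDr raddfD /= scale_scalar_mx mulrCA.
Qed.

(** The element [a z] maps X_x onto X_z, hence the [w d] to a basis of X_z; the scalar undoes the
    factor in [isotypic_map]. *)
Definition isotypic_inv : 'Hom(Y, XX) :=
  linfun (fun f : Y =>
    \sum_d \sum_(z : class_of x)
      ((rho d (a x)^-1%g 0 0 * (f : dsum _) d z 0 0) *:
        (to_class x (yd_act X (a (val z)) (w d)) : XX))).

Lemma isotypic_invE f :
  isotypic_inv f = \sum_d \sum_(z : class_of x)
      ((rho d (a x)^-1%g 0 0 * (f : dsum _) d z 0 0) *:
        (to_class x (yd_act X (a (val z)) (w d)) : XX)).
Proof.
rewrite /isotypic_inv linfun_ext // => k v1 v2.
rewrite scaler_sumr -big_split; apply: eq_bigr => i _ /=.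
rewrite scaler_sumr -big_split; apply: eq_bigr => y _ /=.
by rewrite dsumD dsumZ !ffunE !mxE mulrDr scalerDl scalerA mulrCA.
Qed.

Hypothesis H : isotypic_basis.

Let ax_cent : a x \in 'C[x]%g.
Proof.
have xx : x \in (x ^: [set: gT])%g by rewrite class_refl.
have /= E := class_repP Rx (exist _ x xx).
by apply/cent1P; rewrite /commute -[LHS](mulgKV (a x)) E.
Qed.

Let scalar11 (M : 'M[C]_1) : M = (M 0 0)%:M.
Proof. exact: mx11_scalar. Qed.

Let rhoM d b c : b \in 'C[x]%g -> c \in 'C[x]%g ->
  rho d (b * c)%g 0 0 = rho d b 0 0 * rho d c 0 0.
Proof.
by move=> bC cC; rewrite repr_mxM // mxE big_ord1.
Qed.

Let rho1 d : rho d 1%g 0 0 = 1.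
Proof. by rewrite repr_mx1 mxE. Qed.

Let act_w d (z : class_of x) : yd_act X (a (val z)) (w d) \in yd_gr X (val z).
Proof.
have [wx _ _ _ _] := H; have := memv_img (yd_act X (a (val z))) (wx d).
by rewrite yd_act_gr class_repP.
Qed.

Lemma isotypic_map_basis i :
  isotypic_map (to_class x (w i)) =
  [ffun d => (d == i)%:R *: (ind_vec x x 1%:M : indObj Rx (rho d))].
Proof.
have [wx ellw _ ell0 ella] := H.
apply/ffunP => d; apply/ffunP => z; rewrite isotypic_mapE !ffunE.
have xx : x \in (x ^: [set: gT])%g by rewrite class_refl.
rewrite /= /to_class vsprojK; last by apply: class_vs_gr (wx i).
have [zx|zx] := eqVneq (val z) x.
  (* Here [rho d (a x)] cancels the scalar by which the inverse of [a x] acts. At the other degrees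
     z, the inverse of [a z] moves [w i] out of degree x, where [ell d] vanishes. *)
  rewrite zx ella ?groupV // ellw mulrA -rhoM ?groupV // mulgV rho1 mul1r.
  by rewrite [RHS]scale_scalar_mx mulr1.
rewrite (ell0 _ ((a (val z))^-1 * x * (a (val z))^-1^-1)%g).
- by rewrite mulr0 scaler0 raddf0.
- apply: contraNneq zx => E; have /= <- := class_repP Rx z.
  by rewrite -[X in (_ * X * _)%g]E invgK !mulgA mulgV mul1g mulgK.
- by rewrite -yd_act_gr memv_img.
Qed.

(** Equivariance comes from a'^-1 g = b a^-1, where b = a'^-1 g a in Cen(x) is the cocycle of the
    induced action: [ell d] turns b into the scalar [rho d b]. *)
Lemma isotypic_map_mor : is_ydmor isotypic_map.
Proof.
have [wx ellw _ ell0 ella] := H.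
split=> [y|g].
  apply/subvP => _ /memv_imgP[u uy ->].
  apply/mem_dsum_gr => d; apply/mem_ind_gr => z zy; rewrite isotypic_mapE.
  rewrite (ell0 _ ((a (val z))^-1 * y * (a (val z))^-1^-1)%g).
  - by rewrite mulr0 raddf0.
  - apply: contraNneq zy => E; have /= <- := class_repP Rx z.
    by rewrite -[X in (_ * X * _)%g]E invgK !mulgA mulgV mul1g mulgK.
  - by rewrite -yd_act_gr memv_img // -mem_class_gr.
apply/lfunP => u; apply/ffunP => d; apply/ffunP => z.
rewrite !comp_lfunE isotypic_mapE.
have -> : (yd_act Y g (isotypic_map u) : dsum _) d =
    ind_act Rx (rho d) g ((isotypic_map u : dsum _) d).
  exact: (dsum_actE g (isotypic_map u) d).
rewrite ind_actE isotypic_mapE class_actE /=.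
rewrite [rho d (ind_cocycle _ _ _)]scalar11 -scalar_mxM; congr _%:M.
rewrite mulrCA; congr (_ * _); rewrite -ella ?ind_cocycle_cent //; congr (ell d _).
by rewrite -!yd_actME /ind_cocycle /= !mulgA mulgK.
Qed.

Lemma isotypic_mapK : (isotypic_map \o isotypic_inv)%VF = \1%VF.
Proof.
have [wx ellw _ ell0 ella] := H.
apply/lfunP => f; apply/ffunP => d; apply/ffunP => z.
rewrite comp_lfunE id_lfunE isotypic_mapE isotypic_invE.
have aP := class_repP Rx z.
(* The vector has degree x only if z = z', so the two families are dual to each other. *)
have E d' (z' : class_of x) : ell d (yd_act X (a (val z))^-1%g
    (vsval (to_class x (yd_act X (a (val z')) (w d'))))) =
    ((d == d') && (z == z'))%:R.
  rewrite /to_class vsprojK; last first.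
    exact: class_vs_gr (valP z') (act_w d' z').
  rewrite -yd_actME.
  have [->|zz'] := eqVneq z z'; first by rewrite mulVg yd_act1 id_lfunE ellw andbT.
  set b := (_ * _)%g; rewrite andbF (ell0 _ (b * x * b^-1)%g) //; last first.
    by rewrite -yd_act_gr memv_img.
  apply: contraNneq zz' => E; apply/eqP/val_inj; rewrite /= -aP -[X in (_ * X * _)%g]E.
  by rewrite /b invMg invgK !mulgA mulgV mul1g mulgK class_repP.
rewrite (scalar11 (f d z)); congr _%:M.
rewrite !linear_sum (bigD1 d) //= !linear_sum (bigD1 z) //= !linearZ /= E !eqxx.
rewrite big1 => [|z' /negPf zz']; last by rewrite !linearZ /= E eqxx eq_sym zz' scaler0.
rewrite big1 => [|d' /negPf dd']; last first.
  by rewrite !linear_sum big1 // => z' _; rewrite !linearZ /= E eq_sym dd' scaler0.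
rewrite !addr0 [_ *: _]mulr1 mulrA -rhoM ?groupV ?ax_cent // mulgV.
by rewrite rho1 mul1r.
Qed.

(** The inverse of [a y] moves the component of u at y to degree x, where all its coordinates vanish
    because [rho d (a x)] is invertible. *)
Lemma isotypic_map_inj u : isotypic_map u = 0 -> u = 0.
Proof.
have [wx ellw span ell0 ella] := H => u0.
apply: val_inj => /=; rewrite -(yd_proj_sum (vsval u)) big1 // => y _.
have [yx|yx] := boolP (y \in (x ^: [set: gT])%g); last first.
  by have /class_vs_proj -> := subvsP (u : subvs_of (class_vs X x)).
pose z : class_of x := exist _ y yx; have /= aP := class_repP Rx z.
suff: yd_proj X x (yd_act X (a y)^-1%g (vsval u)) = 0.
  move=> /(congr1 (yd_act X (a y))); rewrite linear0 yd_proj_act aP.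
  by rewrite -yd_actME mulgV yd_act1 id_lfunE.
rewrite (span _ (yd_proj_gr _ _)) big1 // => d _.
have := congr1 (fun f : Y => (f : dsum _) d z 0 0) u0.
rewrite isotypic_mapE dsum0 ffunE !mxE /= mulr1n => /eqP.
rewrite mulf_eq0 => /orP[/eqP r0|/eqP].
  have := rho1 d; rewrite -(mulgV (a x)) rhoM ?groupV ?ax_cent // r0 mul0r.
  by move/esym/eqP; rewrite oner_eq0.
set t := yd_act _ _ _ => e0; suff -> : ell d (yd_proj X x t) = 0 by rewrite scale0r.
rewrite -e0 -[t in RHS]yd_proj_sum linear_sum (bigD1 x) //= big1 ?addr0 // => y' y'x.
by rewrite (ell0 _ y') // yd_proj_gr.
Qed.

Lemma isotypic_map_iso : is_ydiso isotypic_map.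
Proof.
have [wx ellw span ell0 ella] := H; have [phi_gr phi_act] := isotypic_map_mor.
(* An injective linear map with a right inverse has it as a left inverse too. *)
have invK : (isotypic_inv \o isotypic_map)%VF = \1%VF.
  apply/lfunP => u; apply/eqP; rewrite id_lfunE -subr_eq0; apply/eqP.
  apply: isotypic_map_inj; rewrite linearB /= comp_lfunE -[isotypic_map _]comp_lfunE.
  by rewrite isotypic_mapK id_lfunE subrr.
split; first exact: isotypic_map_mor.
exists isotypic_inv; last by split=> //; exact: isotypic_mapK.
split=> [y|g].
  apply/subvP => _ /memv_imgP[f /mem_dsum_gr fy ->]; rewrite isotypic_invE.
  rewrite rpred_sum // => d _; rewrite rpred_sum // => z _.
  have [zy|zy] := eqVneq (val z) y; last first.
    by have /mem_ind_gr -> := fy d; rewrite // mxE mulr0 scale0r mem0v.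
  have wz : yd_act X (a (val z)) (w d) \in yd_gr X y.
    by rewrite -zy act_w.
  rewrite rpredZ // mem_class_gr /to_class vsprojK //.
  by apply: class_vs_gr wz; rewrite -zy; exact: (valP z).
(* Inserting the identity as inverse after map reduces equivariance of the inverse to that of the
   map. *)
have <- : (isotypic_inv \o (isotypic_map \o (yd_act XX g \o isotypic_inv)))%VF
    = (yd_act XX g \o isotypic_inv)%VF by rewrite comp_lfunA invK comp_lfun1l.
rewrite !comp_lfunA -[(_ \o _ \o yd_act XX g)%VF]comp_lfunA phi_act.
by rewrite -!comp_lfunA isotypic_mapK comp_lfun1r.
Qed.

End Isotypic.

(** * Coordinates on an object induced from a character *)

Section IndCoef.
Variables (C : fieldType) (gT : finGroupType) (x : gT) (Rx : coset_reps x).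
Variable rho : mx_representation C 'C[x]%g 1.
Local Notation U := (indObj Rx rho).

(** The sum has at most one term; written so, the coordinate is defined for every y and is 0 outside
    the class. *)
Definition ind_coef (y : gT) : 'Hom(U, C^o) :=
  linfun (fun f : U => \sum_(z : class_of x | val z == y) f z 0 0 : C^o).

Lemma ind_coefE y f :
  ind_coef y f = \sum_(z : class_of x | val z == y) f z 0 0.
Proof.
rewrite /ind_coef linfun_ext // => k u v.
rewrite scaler_sumr -big_split; apply: eq_bigr => z _.
by rewrite !ffunE !mxE.
Qed.

Lemma ind_coef_val (z : class_of x) f : ind_coef (val z) f = f z 0 0.
Proof.
rewrite ind_coefE (bigD1 z) //= big1 ?addr0 // => z' /andP[/eqP zz' /eqP[]].
exact: val_inj.
Qed.

Lemma mem_ind_vec y : (ind_vec x y 1%:M : U) \in yd_gr U y.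
Proof. by apply/mem_ind_gr => z /negPf zy; rewrite ffunE zy. Qed.

Lemma ind_coef_vec y y' : y \in (x ^: [set: gT])%g ->
  ind_coef y (ind_vec x y' 1%:M) = (y == y')%:R.
Proof.
move=> yx; rewrite -[y]/(val (exist (fun z => z \in (x ^: [set: gT])%g) y yx)).
by rewrite ind_coef_val ffunE /=; case: eqP => _; rewrite !mxE.
Qed.

Lemma ind_coef0 y y' f : y != y' -> f \in yd_gr U y' -> ind_coef y f = 0.
Proof.
move=> yy' /mem_ind_gr fy; rewrite ind_coefE big1 // => z /eqP zy.
by rewrite fy ?mxE // zy.
Qed.

Lemma ind_vec_coef y (f : U) : f \in yd_gr U y ->
  f = (ind_coef y f : C) *: (ind_vec x y 1%:M : U).
Proof.
move=> /mem_ind_gr fy; apply/ffunP => z; rewrite !ffunE.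
have [zy|zy] := eqVneq (val z) y; last by rewrite fy // scaler0.
by rewrite -zy ind_coef_val scale_scalar_mx mulr1 -mx11_scalar.
Qed.

Lemma ind_gr_notin y (f : U) : y \notin (x ^: [set: gT])%g ->
  f \in yd_gr U y -> f = 0.
Proof.
move=> yx /mem_ind_gr fy; apply/ffunP => z; rewrite ffunE fy //.
by apply: contraNneq yx => <-; exact: (valP z).
Qed.

(** Since y^g = y, g preserves the line of degree y and acts on it by a scalar. *)
Lemma ind_coef_act y g f : y \in (x ^: [set: gT])%g -> commute g y ->
  ind_coef y (yd_act U g f) = rho (ind_cocycle Rx g y) 0 0 * ind_coef y f.
Proof.
move=> yx gy; pose z : class_of x := exist _ y yx.
rewrite -[y]/(val z) !ind_coef_val ind_actE mxE big_ord1; congr (_ * f _ 0 0).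
by apply: val_inj; rewrite /= /conjg -gy mulKg.
Qed.

End IndCoef.

(** * Tensor products of two such objects *)

Section IndTensor.
Variables (C : fieldType) (gT : finGroupType) (x1 x2 : gT).
Variables (R1 : coset_reps x1) (R2 : coset_reps x2).
Variables (rho1 : mx_representation C 'C[x1]%g 1).
Variables (rho2 : mx_representation C 'C[x2]%g 1).
Local Notation U1 := (indObj R1 rho1).
Local Notation U2 := (indObj R2 rho2).

Definition ind_tens (y z : gT) : tensorObj U1 U2 :=
  ydtens (ind_vec x1 y 1%:M : U1) (ind_vec x2 z 1%:M : U2).

Definition ind_tens_coef (y z : gT) : 'Hom(tensorObj U1 U2, C^o) :=
  tens_fun (ind_coef R1 rho1 y) (ind_coef R2 rho2 z).

(** The pairs (y i, z i) are all the factorizations of x in the two classes, so their lines span the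
    component at x; Cen(x) centralizes both factors, so it preserves each line. Injectivity of [z]
    separates the pairs, as y i is determined by z i. *)
Lemma ind_tens_isotypic (x : gT) (I : finType) (y z : I -> gT)
    (rho : I -> mx_representation C 'C[x]%g 1) :
  (forall i, y i \in x1 ^: [set: gT])%g -> (forall i, z i \in x2 ^: [set: gT])%g ->
  (forall i, y i * z i = x)%g -> injective z ->
  (forall y' z', y' \in x1 ^: [set: gT] -> z' \in x2 ^: [set: gT] ->
     y' * z' = x -> exists i, y' = y i /\ z' = z i)%g ->
  (forall i b, b \in 'C[x]%g ->
     [/\ commute b (y i), commute b (z i) &
         rho1 (ind_cocycle R1 b (y i)) 0 0 * rho2 (ind_cocycle R2 b (z i)) 0 0
         = rho i b 0 0]) ->
  isotypic_basis rho (fun i => ind_tens (y i) (z i))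
    (fun i => ind_tens_coef (y i) (z i)).
Proof.
move=> yP zP yz z_inj yz_ex rhoP; split.
- by move=> i; rewrite -(yz i); apply: mem_tensor_gr; apply: mem_ind_vec.
- move=> i j; rewrite /ind_tens_coef tens_funE !ind_coef_vec // (inj_eq z_inj).
  by have [->|_] := eqVneq i j; rewrite ?eqxx ?mulr1 ?mulr0.
(* With the expansion made an endomorphism, the claim is that it agrees with the identity on a
   subspace, which can be tested on generating pure tensors. *)
- pose L : 'End(tensorObj U1 U2) := linfun (fun u : tensorObj U1 U2 =>
    \sum_i (ind_tens_coef (y i) (z i) u : C) *: ind_tens (y i) (z i)).
  have LE u : L u =
      \sum_i (ind_tens_coef (y i) (z i) u : C) *: ind_tens (y i) (z i).
    rewrite /L linfun_ext // => k u' v'.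
    rewrite scaler_sumr -big_split; apply: eq_bigr => i _ /=.
    by rewrite linearP scalerDl scalerA.
  move=> u ux; rewrite -LE -[LHS]id_lfunE; apply/eqlfunP; apply: subvP ux.
  apply: tensor_gr_sub => y' z' a b yz' ay bz; apply/eqlfunP.
  rewrite id_lfunE LE.
  have [y'P|y'P] := boolP (y' \in x1 ^: [set: gT])%g; last first.
    rewrite (ind_gr_notin y'P ay) tens0l big1 // => i _.
    by rewrite linear0 scale0r.
  have [z'P|z'P] := boolP (z' \in x2 ^: [set: gT])%g; last first.
    rewrite (ind_gr_notin z'P bz) tens0r big1 // => i _.
    by rewrite linear0 scale0r.
  have [i [yi zi]] := yz_ex _ _ y'P z'P yz'.
  rewrite (bigD1 i) //= big1 ?addr0 => [|j ji].
    rewrite /ind_tens_coef tens_funE -yi -zi.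
    rewrite {1}(ind_vec_coef ay) {1}(ind_vec_coef bz).
    by rewrite tens_scalel tens_scaler scalerA.
  rewrite /ind_tens_coef tens_funE (@ind_coef0 _ _ _ _ _ (z j) z') ?mulr0 ?scale0r //.
  by rewrite zi (inj_eq z_inj).
- move=> i x' u x'x ux; apply/eqP; rewrite -memv_ker; apply: subvP ux.
  apply: tensor_gr_sub => y' z' a b yz' ay bz; rewrite memv_ker.
  rewrite /ind_tens_coef tens_funE.
  have [yi|yi] := eqVneq (y i) y'; last by rewrite (ind_coef0 yi ay) mul0r.
  have [zi|zi] := eqVneq (z i) z'; last by rewrite (ind_coef0 zi bz) mulr0.
  by rewrite -yz' -yi -zi yz eqxx in x'x.
- move=> i b u bC; have [by' bz E] := rhoP i b bC.
  (* Multiplication by the scalar is made a linear map, so that pure tensors suffice. *)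
  pose m : 'End(C^o) := rho i b 0 0 *: \1%VF.
  have -> : rho i b 0 0 * ind_tens_coef (y i) (z i) u =
      (m \o ind_tens_coef (y i) (z i))%VF u.
    by rewrite comp_lfunE scale_lfunE id_lfunE.
  rewrite -comp_lfunE; congr (fun_of_lfun _ u); apply: tensor_ext => a a'.
  rewrite !comp_lfunE scale_lfunE id_lfunE /= tensfE /ind_tens_coef !tens_funE.
  rewrite !ind_coef_act // -E; exact: mulrACA.
Qed.

End IndTensor.

(** As y commutes with z, L_y preserves the line of degree z, so the braiding swaps the two lines up
    to the scalar of that action. *)
Lemma ind_tens_coef_braiding (C : fieldType) (gT : finGroupType) (x1 x2 : gT)
    (R1 : coset_reps x1) (R2 : coset_reps x2)
    (rho1 : mx_representation C 'C[x1]%g 1) (rho2 : mx_representation C 'C[x2]%g 1)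
    (y z : gT) (u : tensorObj (indObj R1 rho1) (indObj R2 rho2)) :
  z \in (x2 ^: [set: gT])%g -> commute y z ->
  ind_tens_coef R2 R1 rho2 rho1 z y (braiding _ _ u) =
  rho2 (ind_cocycle R2 y z) 0 0 * ind_tens_coef R1 R2 rho1 rho2 y z u.
Proof.
move=> zP yz; pose m : 'End(C^o) := rho2 (ind_cocycle R2 y z) 0 0 *: \1%VF.
have -> : rho2 (ind_cocycle R2 y z) 0 0 * ind_tens_coef R1 R2 rho1 rho2 y z u
    = (m \o ind_tens_coef R1 R2 rho1 rho2 y z)%VF u.
  by rewrite comp_lfunE scale_lfunE id_lfunE.
rewrite -comp_lfunE; congr (fun_of_lfun _ u); apply: tensor_ext => a b.
rewrite !comp_lfunE scale_lfunE id_lfunE /ind_tens_coef tens_funE.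
(* Among the homogeneous components of a, only the one of degree y contributes to either side. *)
rewrite -(yd_proj_sum a) tens_suml !linear_sum mulr_suml scaler_sumr.
apply: eq_bigr => y' _ /=; have ay := yd_proj_gr y' a.
rewrite (@braidingE _ _ _ (indObj R2 rho2) _ _ b ay) tens_funE.
have [<-|yy'] := eqVneq y y'; last first.
  by rewrite (ind_coef0 yy' ay) mulr0 mul0r scaler0.
by rewrite ind_coef_act // -mulrA [_ * ind_coef _ _ y _]mulrC.
Qed.

(** * Conjugacy classes of the elements mu b(s) *)

Section SL2Class.
Variable F : finFieldType.
Implicit Types (s t c k : F) (g : SL2 F).

Lemma SL2M g g' i j :
  val (g * g')%g i j = val g i 0 * val g' 0 j + val g i 1 * val g' 1 j.
Proof.
have l1 : lift ord0 ord0 = 1 :> 'I_2 by apply: val_inj.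
by rewrite /= mxE !big_ord_recl big_ord0 addr0 l1.
Qed.

Lemma ord2P (i : 'I_2) : i = 0 \/ i = 1.
Proof. by case: i => [[|[|//]] lti]; [left | right]; apply: val_inj. Qed.

Lemma SL2P g g' :
  val g 0 0 = val g' 0 0 -> val g 0 1 = val g' 0 1 ->
  val g 1 0 = val g' 1 0 -> val g 1 1 = val g' 1 1 -> g = g'.
Proof.
move=> e00 e01 e10 e11; apply/val_inj/matrixP => i j.
by case: (ord2P i) => ->; case: (ord2P j) => ->.
Qed.

Lemma mub10 mu c : val (mub mu c) 1 0 = 0.
Proof. by rewrite /= !mxE /= mulr0. Qed.

Lemma mub11 mu c : val (mub mu c) 1 1 = (-1) ^+ mu.
Proof. by rewrite /= !mxE /= mulr1. Qed.

Definition mubE := (mub00, mub01, mub10, mub11).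

Lemma mubM mu mu' c c' : (mub mu c * mub mu' c')%g = mub (mu (+) mu') (c + c').
Proof.
apply: SL2P; rewrite SL2M !mubE ?signr_addb; ring.
Qed.

Lemma mub_commute mu mu' c c' : commute (mub mu c) (mub mu' c').
Proof. by rewrite /commute !mubM addbC addrC. Qed.

Lemma mub_injr mu : injective (mub mu : F -> SL2 F).
Proof.
move=> c c' /(congr1 (fun g => val g 0 1)); rewrite !mub01.
by apply: mulfI; rewrite signr_eq0.
Qed.

Lemma cent_mub mu c g : c != 0 -> g \in 'C[mub mu c]%g ->
  exists m c', g = mub m c'.
Proof.
move=> c0 /(SL2_cent c0)[g10 [g00 g11]]; case: g00 => g00.
  exists false, (val g 0 1); apply: SL2P; rewrite !mubE //=; first by rewrite mul1r.
  by rewrite g11 g00.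
exists true, (- val g 0 1); apply: SL2P; rewrite !mubE //=; first by rewrite mulrNN mul1r.
by rewrite g11 g00.
Qed.

(* Such a g is diag(k, 1/k) up to an element of Cen(mub mu s). *)
Lemma mub_conj mu s k g m c : s != 0 -> k != 0 ->
  (g * mub mu s * g^-1)%g = mub mu (s * k ^+ 2) ->
  (g^-1 * mub m c * g)%g = mub m (k ^- 2 * c).
Proof.
move=> s0 k0 /(canRL (mulgKV _)) E.
have sg b : (-1) ^+ b != 0 :> F by rewrite signr_eq0.
have Eij i j : val (g * mub mu s)%g i j = val (mub mu (s * k ^+ 2)%R * g)%g i j.
  exact: (congr1 (fun u : SL2 F => val u i j) E).
(* These two entries force g to be upper triangular with diagonal ratio k^2. *)
have := (Eij 0 1, Eij 1 1); rewrite !SL2M !mubE => -[E01 E11].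
have g10 : val g 1 0 = 0.
  apply: (mulfI (mulf_neq0 (sg mu) s0)); rewrite mulr0.
  by move/eqP: E11; rewrite -subr_eq0 => /eqP E11; rewrite -[RHS]E11; ring.
have g00 : val g 0 0 = k ^+ 2 * val g 1 1.
  apply: (mulfI (mulf_neq0 (sg mu) s0)); apply/eqP; rewrite -subr_eq0.
  move/eqP: E01; rewrite -subr_eq0 => /eqP <-; apply/eqP; ring.
apply: (mulgI g); rewrite !mulgA mulgV mul1g.
apply: SL2P; rewrite !SL2M !mubE ?g10 ?g00; try ring.
by field.
Qed.

Lemma SL2_ex a b c d : a * d - b * c = 1 -> exists g,
  [/\ val g 0 0 = a, val g 0 1 = b, val g 1 0 = c & val g 1 1 = d].
Proof.
pose M : 'M[F]_2 := \matrix_(i, j)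
  if i == 0 then (if j == 0 then a else b) else (if j == 0 then c else d).
move=> d1; have P : \det M == 1 by rewrite det22 !mxE /= d1.
by exists (Sub M P : SL2 F); rewrite /= !mxE.
Qed.

Lemma mem_class_mub mu s k : k != 0 ->
  mub mu (s * k ^+ 2) \in (mub mu s ^: [set: SL2 F])%g.
Proof.
(* The conjugating matrix is diag(k, 1/k). *)
move=> k0; have [|g [g00 g01 g10 g11]] := @SL2_ex k 0 0 k^-1; first by field.
have -> : mub mu (s * k ^+ 2) = (mub mu s ^ g^-1)%g; last by rewrite memJ_class ?inE.
rewrite /conjg invgK; apply: (mulIg g); rewrite mulgA mulgKV.
by apply: SL2P; rewrite !SL2M !mubE ?(g00, g01, g10, g11); field.
Qed.

Lemma SL2V g : [/\ val g^-1%g 0 0 = val g 1 1, val g^-1%g 0 1 = - val g 0 1,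
  val g^-1%g 1 0 = - val g 1 0 & val g^-1%g 1 1 = val g 0 0].
Proof.
have d1 := eqP (valP g); rewrite det22 in d1.
have [|g' [g00 g01 g10 g11]] := @SL2_ex (val g 1 1) (- val g 0 1) (- val g 1 0) (val g 0 0).
  by apply: etrans d1; ring.
suff -> : (g^-1)%g = g' by [].
apply: (mulgI g); rewrite mulgV.
apply: SL2P; rewrite SL2M ?(g00, g01, g10, g11) mxE /=; try ring.
  by apply: etrans (esym d1) _; ring.
by apply: etrans (esym d1) _; ring.
Qed.

(* With (c, d) the lower row of the conjugating matrix. *)
Lemma class_mubP mu s y : y \in (mub mu s ^: [set: SL2 F])%g ->
  exists (c d : F),
  [/\ (c != 0) || (d != 0),
     val y 0 0 = (-1) ^+ mu * (1 + s * (c * d)),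
     val y 0 1 = (-1) ^+ mu * (s * d ^+ 2),
     val y 1 0 = - ((-1) ^+ mu * (s * c ^+ 2)) &
     val y 1 1 = (-1) ^+ mu * (1 - s * (c * d))].
Proof.
case/imsetP => g _ ->; exists (val g 1 0), (val g 1 1).
have d1 := eqP (valP g); rewrite det22 in d1.
have [v00 v01 v10 v11] := SL2V g.
have sd1 b : b = b * (val g 0 0 * val g 1 1 - val g 0 1 * val g 1 0).
  by rewrite d1 mulr1.
split; rewrite ?[(_ ^ _)%g]/(_ * (_ * _))%g ?SL2M ?mubE ?(v00, v01, v10, v11).
- rewrite -negb_and; apply/negP => /andP[/eqP g10 /eqP g11].
  by move/eqP: d1; rewrite g10 g11 !mulr0 subrr eq_sym oner_eq0.
- by rewrite [RHS]mulrDr mulr1 [X in _ = X + _]sd1; ring.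
- by ring.
- by ring.
- by rewrite [RHS]mulrBr mulr1 [X in _ = X + _]sd1; ring.
Qed.

(* If unipotents 1 + A and 1 + B have product 1 + t N with N strictly upper
   triangular, then tr (A B) = 0; as A and B are of rank one with square zero,
   they have the same kernel, which is then that of N. *)
Lemma mub_factors mu1 s1 mu2 s2 t y z : s1 != 0 -> s2 != 0 -> t != 0 ->
  y \in (mub mu1 s1 ^: [set: SL2 F])%g -> z \in (mub mu2 s2 ^: [set: SL2 F])%g ->
  (y * z)%g = mub (mu1 (+) mu2) t ->
  exists k1 k2, [/\ k1 != 0, k2 != 0,
    y = mub mu1 (s1 * k1 ^+ 2), z = mub mu2 (s2 * k2 ^+ 2) &
    s1 * k1 ^+ 2 + s2 * k2 ^+ 2 = t].
Proof.
move=> s10 s20 t0 /class_mubP[c1 [d1 [n1 y00 y01 y10 y11]]].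
case/class_mubP => [c2 [d2 [n2 z00 z01 z10 z11]]] E.
have Eij i j : val (y * z)%g i j = val (mub (mu1 (+) mu2) t) i j.
  exact: (congr1 (fun u : SL2 F => val u i j) E).
have := (Eij 0 0, Eij 0 1, Eij 1 0, Eij 1 1); rewrite !SL2M !mubE signr_addb.
rewrite y00 y01 y10 y11 z00 z01 z10 z11 => -[[[E00 E01] E10] E11].
have cancel (M : F) : (-1) ^+ mu1 * (-1) ^+ mu2 * M = 0 -> M = 0.
  by move/eqP; rewrite !mulf_eq0 !signr_eq0 => /eqP.
have {}E00 : s1 * (c1 * d1) + s2 * (c2 * d2) +
    s1 * s2 * (d1 * c2) * (c1 * d2 - d1 * c2) = 0.
  apply: cancel; move/eqP: E00; rewrite -subr_eq0 => /eqP <-; ring.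
have {}E01 : s1 * d1 ^+ 2 + s2 * d2 ^+ 2 +
    s1 * s2 * (d1 * d2) * (c1 * d2 - d1 * c2) = t.
  apply/eqP; rewrite -subr_eq0; apply/eqP.
  apply: cancel; move/eqP: E01; rewrite -subr_eq0 => /eqP <-; ring.
have {}E10 : s1 * c1 ^+ 2 + s2 * c2 ^+ 2 +
    s1 * s2 * (c1 * c2) * (c1 * d2 - d1 * c2) = 0.
  apply: cancel; move/eqP: E10; rewrite -(inj_eq oppr_inj) oppr0 => /eqP <-; ring.
have {}E11 : - (s1 * (c1 * d1) + s2 * (c2 * d2)) -
    s1 * s2 * (c1 * d2) * (c1 * d2 - d1 * c2) = 0.
  apply: cancel; move/eqP: E11; rewrite -subr_eq0 => /eqP <-; ring.
(* The diagonal equations add up to - s1 s2 (c1 d2 - d1 c2)^2 = 0, the trace condition; hence the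
   two lower rows are proportional. *)
have cd : c1 * d2 - d1 * c2 = 0.
  have : s1 * s2 * (c1 * d2 - d1 * c2) ^+ 2 = 0.
    by rewrite -[RHS]oppr0 -[in RHS](addr0 0) -{1}E00 -{1}E11; ring.
  by move/eqP; rewrite 2!mulf_eq0 (negPf s10) (negPf s20) expf_eq0 => /eqP.
rewrite cd !mulr0 !addr0 in E01 E10.
have c20 : c1 = 0 -> c2 = 0.
  move=> c10; move/eqP: E10; rewrite c10 expr0n mulr0 add0r.
  by rewrite mulf_eq0 (negPf s20) expf_eq0 => /eqP.
(* Proportionality gives c1^2 t = d1^2 (s1 c1^2 + s2 c2^2) = 0, while t is nonzero. *)
have c10 : c1 = 0.
  apply/eqP; apply/negPn/negP => c1n; move/eqP: t0; apply.
  have : c1 ^+ 2 * t = 0.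
    have d2E : c1 * d2 = d1 * c2 by apply/eqP; rewrite -subr_eq0 cd.
    rewrite -E01 mulrDr mulrCA [X in _ + X]mulrCA -[X in _ + _ * X]exprMn d2E.
    by transitivity (d1 ^+ 2 * 0); [rewrite -E10; ring | rewrite mulr0].
  by move/eqP; rewrite mulf_eq0 expf_eq0 (negPf c1n) => /eqP.
have {}c20 := c20 c10; subst c1 c2; rewrite eqxx /= in n1 n2.
by exists d1, d2; split=> //; apply: SL2P; rewrite ?mubE
  ?(y00, y01, y10, y11) ?(z00, z01, z10, z11); ring.
Qed.

End SL2Class.

(** * Powers of e and the index set H' *)

Lemma order_unit_power (F K : finFieldType) (iota : {rmorphism F -> K})
    (u : {unit K}) (e : {unit F}) (m k : nat) :
  generator [set: {unit K}] u -> (0 < k)%N -> #|K| = (m * k).+1 ->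
  iota (val e) = val u ^+ k -> #[e]%g = m.
Proof.
move=> /eqP gen k0 cardK eE.
have ord_u : #[u]%g = (m * k)%N by rewrite orderE -gen card_finField_unit cardK.
(* Both divisibilities are checked in K, where [u] has order m k. *)
apply/eqP; rewrite eqn_dvd order_dvdn; apply/andP; split.
  rewrite -(inj_eq val_inj) FinRing.val_unitX; apply/eqP/(fmorph_inj iota).
  by rewrite rmorphXn eE -exprM mulnC -ord_u -FinRing.val_unitX expg_order rmorph1.
rewrite -(@dvdn_pmul2r k) // -ord_u order_dvdn mulnC.
rewrite -(inj_eq val_inj) FinRing.val_unitX exprM -eE -rmorphXn.
by rewrite -FinRing.val_unitX expg_order rmorph1.
Qed.

Section Powers.
Variables (F : finFieldType) (e : {unit F}) (h : nat).
Hypotheses (ord_e : #[e]%g = (4 * h)%N) (cardF : #|F| = (4 * h).+1).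
Hypothesis h_gt0 : (0 < h)%N.

Lemma eq_unit_expr i j : (val e ^+ i == val e ^+ j) = (i == j %[mod 4 * h]).
Proof.
by rewrite -!FinRing.val_unitX (inj_eq val_inj) eq_expg_mod_order ord_e.
Qed.

Lemma unit_log a : a != 0 -> exists k, a = val e ^+ k.
Proof.
rewrite -unitfE => aU; pose u : {unit F} := FinRing.Unit aU.
have : u \in <[e]>%g.
  suff -> : <[e]>%g = [set: {unit F}] by rewrite inE.
  apply/eqP; rewrite eqEcard subsetT /= -orderE ord_e card_finField_unit.
  by rewrite cardF.
by case/cycleP => k uE; exists k; rewrite -FinRing.val_unitX -uE.
Qed.

(** e^(2k) depends only on k modulo 2h, and [1, 2h] is a full set of residues in which 2h stands for
    0. *)
Lemma even_power_index k : exists2 i : 'I_(2 * h).+1, (0 < i)%N &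
  forall b, val e ^+ (2 * k + b) = val e ^+ (2 * i + b).
Proof.
have h2 : (0 < 2 * h)%N by rewrite muln_gt0.
have [k0|k0] := posnP (k %% (2 * h)).
  exists ord_max => // b; apply/eqP; rewrite eq_unit_expr eqn_modDr /=.
  have -> : (4 * h = 2 * (2 * h))%N by rewrite mulnA.
  by rewrite -!muln_modr k0 modnn.
have kP : (k %% (2 * h) < (2 * h).+1)%N by rewrite ltnS ltnW // ltn_pmod.
exists (Ordinal kP) => // b; apply/eqP; rewrite eq_unit_expr eqn_modDr /=.
have -> : (4 * h = 2 * (2 * h))%N by rewrite mulnA.
by rewrite -!muln_modr modn_mod.
Qed.

Lemma even_power_inj (i j : 'I_(2 * h).+1) b : (0 < i)%N -> (0 < j)%N ->
  val e ^+ (2 * i + b) = val e ^+ (2 * j + b) -> i = j.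
Proof.
move=> i0 j0 /eqP; rewrite eq_unit_expr eqn_modDr.
have -> : (4 * h = 2 * (2 * h))%N by rewrite mulnA.
rewrite -!muln_modr eqn_pmul2l // => /eqP ij; apply: val_inj => /=.
have H (k : 'I_(2 * h).+1) : (0 < k)%N ->
    k = (if k %% (2 * h) == 0 then 2 * h else k %% (2 * h))%N :> nat.
  move=> k0; have := ltn_ord k; rewrite ltnS leq_eqVlt => /orP[/eqP kE|kh].
    by rewrite {2}kE modnn.
  by rewrite modn_small // eqn0Ngt k0.
by rewrite (H i) // (H j) // ij.
Qed.

Lemma nzsquareP a : reflect (exists k, a = val e ^+ (2 * k)) (nzsquare a).
Proof.
apply: (iffP existsP) => [[z /andP[z0 /eqP ->]]|[k ->]].
  by have [k ->] := unit_log z0; exists k; rewrite -exprM mulnC.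
exists (val e ^+ k); rewrite -exprM mulnC eqxx andbT.
exact: unit_exp_neq0.
Qed.

(** The nonzero squares are the even powers of e, so the square condition provides the second
    index. *)
Lemma HsetP (eps eps1 eps2 : bool) (i : 'I_(2 * h).+1) :
  reflect ((0 < i)%N /\ exists2 j : 'I_(2 * h).+1, (0 < j)%N &
     val e ^+ eps - val e ^+ (2 * i + eps2) = val e ^+ (2 * j + eps1))
  (i \in Hset e h eps eps1 eps2).
Proof.
have e1 := unit_exp_neq0 e eps1.
rewrite inE; apply: (iffP andP) => -[i0 H]; split=> //.
  have /nzsquareP[k E] := H; have [j j0 jE] := even_power_index k.
  by exists j => //; rewrite -jE [RHS]exprD -E mulfVK.
have [j _ E] := H; apply/nzsquareP; exists j.
by rewrite E exprD mulfK.
Qed.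

Lemma hatE (eps eps1 eps2 : bool) (i j : 'I_(2 * h).+1) : (0 < j)%N ->
  val e ^+ eps - val e ^+ (2 * i + eps2) = val e ^+ (2 * j + eps1) ->
  hat e eps eps1 eps2 i = j.
Proof.
move=> j0 E; rewrite /hat; case: pickP => [k /andP[k0 /eqP Ek]|/(_ j)].
  by apply: (even_power_inj k0 j0 (b := eps1)); rewrite -E -Ek.
by rewrite j0 E eqxx.
Qed.

(** On H' the search in [hat] succeeds, so its default value [ord0] does not occur. *)
Lemma hatP (eps eps1 eps2 : bool) (i : 'I_(2 * h).+1) :
  i \in Hset e h eps eps1 eps2 ->
  [/\ (0 < i)%N, (0 < hat e eps eps1 eps2 i)%N &
   val e ^+ eps - val e ^+ (2 * i + eps2) =
   val e ^+ (2 * hat e eps eps1 eps2 i + eps1)].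
Proof. by case/HsetP => i0 [j j0 E]; rewrite (hatE j0 E). Qed.

(** The equation e^eps = e^(2i + eps2) + e^(2 \hat i + eps1) is symmetric in its two terms. *)
Lemma hat_swap (eps eps1 eps2 : bool) (i : 'I_(2 * h).+1) :
  i \in Hset e h eps eps1 eps2 ->
  hat e eps eps1 eps2 i \in Hset e h eps eps2 eps1 /\
  hat e eps eps2 eps1 (hat e eps eps1 eps2 i) = i.
Proof.
move=> /hatP[i0 j0 E].
have E' : val e ^+ eps - val e ^+ (2 * hat e eps eps1 eps2 i + eps1) =
    val e ^+ (2 * i + eps2) by rewrite -E subKr.
by split; [apply/HsetP; split=> //; exists i | exact: hatE].
Qed.

Lemma Hset_swap (eps eps1 eps2 : bool) :
  Hset e h eps eps2 eps1 =
  [set hat e eps eps1 eps2 d | d in Hset e h eps eps1 eps2].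
Proof.
apply/setP => j; apply/idP/imsetP => [jH|[i iH ->]].
  by have [iH iE] := hat_swap jH; exists (hat e eps eps2 eps1 j).
by have [] := hat_swap iH.
Qed.

Lemma summand_v_swap (eps eps1 eps2 : bool) (v1 v2 : F) (d : 'I_(2 * h).+1) :
  d \in Hset e h eps eps1 eps2 ->
  summand_v e eps eps2 v2 eps1 v1 (hat e eps eps1 eps2 d) =
  val e ^- (2 * d) * v2 + val e ^- (2 * hat e eps eps1 eps2 d) * v1.
Proof. by case/hat_swap => _ dE; rewrite /summand_v dE. Qed.

End Powers.

(** * The decomposition of the class part of X1 (.) X2 *)

Section Decomposition.
Variables (R : realType) (p h : nat) (F : finFieldType).
Variables (chF : p \in [pchar F]) (p_odd : odd p) (e : {unit F}).
Variable reps : forall x : SL2 F, coset_reps x.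
Hypotheses (ord_e : #[e]%g = (4 * h)%N) (cardF : #|F| = (4 * h).+1).
Hypothesis h_gt0 : (0 < h)%N.

Local Notation chi mu eps nu v := (nuv_at R chF e mu eps nu v).
Local Notation RB mu eps := (reps (mub mu (val e ^+ eps))).
Local Notation y mu eps i := (mub mu (val e ^+ (2 * i + eps))).

Lemma power_class mu (eps : bool) i :
  y mu eps i \in (mub mu (val e ^+ eps)%R ^: [set: SL2 F])%g.
Proof.
rewrite addnC exprD mulnC exprM.
by apply: mem_class_mub; rewrite unit_exp_neq0.
Qed.

Lemma nuv_atE mu eps nu v m c :
  chi mu eps nu v (mub m c) 0 0 =
  ((-1) ^+ m) ^+ nu * zeta R p ^+ trF chF (v * c).
Proof. by rewrite mxE eqxx nuv_charE. Qed.

(** As m b(c) commutes with the degree, the cocycle is a^-1 (m b(c)) a, where a is the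
    representative of that degree. By [mub_conj] with k = e^i this is m b(e^(-2i) c), whatever
    representative was chosen. *)
Lemma nuv_at_cocycle mu (eps : bool) nu v i m c :
  chi mu eps nu v (ind_cocycle (RB mu eps) (mub m c) (y mu eps i)) 0 0 =
  ((-1) ^+ m) ^+ nu * zeta R p ^+ trF chF (val e ^- (2 * i) * v * c).
Proof.
have yE : y mu eps i = mub mu (val e ^+ eps * (val e ^+ i) ^+ 2).
  by rewrite addnC exprD mulnC exprM.
pose Y : class_of (mub mu (val e ^+ eps)) :=
  @exist _ (fun z => z \in (mub mu (val e ^+ eps)%R ^: [set: SL2 F])%g) _
    (power_class mu eps i).
have /= aP := class_repP (RB mu eps) Y.
rewrite /ind_cocycle conjgE -(mub_commute m mu) mulKg mulgA.
have e0 k : val e ^+ k != 0 := unit_exp_neq0 e k.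
rewrite (mub_conj _ _ (e0 _) (e0 _) (etrans aP yE)) (nuv_atE mu eps).
by rewrite -[_ ^+ i ^+ 2]exprM [(i * 2)%N]mulnC [v * _]mulrCA mulrA.
Qed.

Variables (mu eps nu mu1 eps1 nu1 mu2 eps2 nu2 : bool) (v1 v2 : F).
Hypotheses (mu_eq : mu1 (+) mu2 = mu) (nu_eq : nu1 (+) nu2 = nu).

Local Notation hat12 := (hat e eps eps1 eps2).
Local Notation H12 := (Hidx e h eps eps1 eps2).

(** [mub_factors] provides all factorizations of mu b_eps, and [nuv_at_cocycle] the scalars by which
    its centralizer acts on the two factors. *)
Lemma SL2_isotypic :
  isotypic_basis (x := mub mu (val e ^+ eps))
    (fun i : H12 => chi mu eps nu (summand_v e eps eps1 v1 eps2 v2 (val i)))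
    (fun i : H12 => ind_tens (RB mu1 eps1) (RB mu2 eps2)
       (chi mu1 eps1 nu1 v1) (chi mu2 eps2 nu2 v2)
       (y mu1 eps1 (hat12 (val i))) (y mu2 eps2 (val i)))
    (fun i : H12 => ind_tens_coef (RB mu1 eps1) (RB mu2 eps2)
       (chi mu1 eps1 nu1 v1) (chi mu2 eps2 nu2 v2)
       (y mu1 eps1 (hat12 (val i))) (y mu2 eps2 (val i))).
Proof.
have HP (i : H12) := hatP ord_e cardF h_gt0 (valP i).
apply: ind_tens_isotypic.
- by move=> i; exact: power_class.
- by move=> i; exact: power_class.
- by move=> i; have [_ _ E] := HP i; rewrite mubM mu_eq -E subrK.
- move=> i j /mub_injr E; have [i0 _ _] := HP i; have [j0 _ _] := HP j.
  by apply/val_inj; exact: even_power_inj E.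
- move=> y' z' y'P z'P; rewrite -mu_eq => E.
  have [|||k1 [k2 [k10 k20 -> -> kE]]] := mub_factors _ _ _ y'P z'P E;
    rewrite ?unit_exp_neq0 //.
  (* k1 and k2 are powers of e, so each e^eps_j k_j^2 has an index in [1, 2h]. *)
  have [l1 l1E] := unit_log ord_e cardF k10; have [l2 l2E] := unit_log ord_e cardF k20.
  have [i1 i10 /(_ eps1) i1E] := even_power_index ord_e h_gt0 l1.
  have [i2 i20 /(_ eps2) i2E] := even_power_index ord_e h_gt0 l2.
  have kE1 : val e ^+ eps1 * k1 ^+ 2 = val e ^+ (2 * i1 + eps1).
    by rewrite -i1E exprD mulrC [(2 * _)%N]mulnC exprM -l1E.
  have kE2 : val e ^+ eps2 * k2 ^+ 2 = val e ^+ (2 * i2 + eps2).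
    by rewrite -i2E exprD mulrC [(2 * _)%N]mulnC exprM -l2E.
  have E12 : val e ^+ eps - val e ^+ (2 * i2 + eps2) = val e ^+ (2 * i1 + eps1).
    by rewrite -kE1 -kE2 -kE addrK.
  have iH : i2 \in Hset e h eps eps1 eps2.
    by apply/HsetP => //; split=> //; exists i1.
  by exists (exist _ i2 iH); rewrite /= (hatE ord_e i10 E12) kE1 kE2.
- move=> i b /cent_mub[|m [c ->]]; first exact: unit_exp_neq0.
  split; try exact: mub_commute.
  (* The exponents e^(-2 \hat i) v1 c and e^(-2i) v2 c add up to [summand_v] times c, and the signs
     multiply to (-1)^(m nu). *)
  apply: etrans (congr2 *%R (nuv_at_cocycle _ _ _ _ _ _ _)
                            (nuv_at_cocycle _ _ _ _ _ _ _)) _.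
  rewrite (nuv_atE mu eps) mulrACA -zeta_trD -!exprM -exprD -mulrDl -nu_eq.
  by congr (_ * _); case: (m); case: (nu1); case: (nu2); rewrite //= sqrrN expr1n.
Qed.

Definition SL2_decomposition :
    'Hom(classObj (tensorObj (Bobj R chF e reps mu1 eps1 nu1 v1)
                             (Bobj R chF e reps mu2 eps2 nu2 v2))
                  (mub mu (val e ^+ eps)),
         Bsum R chF e reps h mu eps nu eps1 v1 eps2 v2) :=
  isotypic_map (RB mu eps)
    (fun i : H12 => chi mu eps nu (summand_v e eps eps1 v1 eps2 v2 (val i)))
    (fun i : H12 => ind_tens_coef (RB mu1 eps1) (RB mu2 eps2)
       (chi mu1 eps1 nu1 v1) (chi mu2 eps2 nu2 v2)
       (y mu1 eps1 (hat12 (val i))) (y mu2 eps2 (val i))).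

Lemma SL2_decompositionP :
  is_decomposition mu eps nu mu1 eps1 nu1 v1 mu2 eps2 nu2 v2 SL2_decomposition.
Proof.
by split=> [|i]; [exact: isotypic_map_iso SL2_isotypic
                 | exact: isotypic_map_basis SL2_isotypic i].
Qed.

End Decomposition.

(** * The braiding in terms of the decompositions *)

Section Braiding.
Variables (R : realType) (p h : nat) (F : finFieldType).
Variables (chF : p \in [pchar F]) (p_odd : odd p) (e : {unit F}).
Variable reps : forall x : SL2 F, coset_reps x.
Hypotheses (ord_e : #[e]%g = (4 * h)%N) (cardF : #|F| = (4 * h).+1).
Hypothesis h_gt0 : (0 < h)%N.
Variables (mu eps nu mu1 eps1 nu1 mu2 eps2 nu2 : bool) (v1 v2 : F).
Hypotheses (mu_eq : mu1 (+) mu2 = mu) (nu_eq : nu1 (+) nu2 = nu).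

Local Notation chi mu eps nu v := (nuv_at R chF e mu eps nu v).
Local Notation y mu eps i := (mub mu (val e ^+ (2 * i + eps))).
Local Notation hat12 := (hat e eps eps1 eps2).
Local Notation coef d :=
  (((-1) ^+ mu) ^+ nu2 / theta (chi mu2 eps2 nu2 v2)
   * zeta R p ^+ trF chF (val e ^+ eps * val e ^- (2 * val d) * v2)).

(* The vector of degree y2(d) is acted upon by the degree of its left factor,
   y1(d) = mu1 b(e^eps - e^(2d + eps2)). *)
Lemma braiding_scalar (d : Hidx e h eps eps1 eps2) :
  chi mu2 eps2 nu2 v2 (ind_cocycle (reps (mub mu2 (val e ^+ eps2)))
    (y mu1 eps1 (hat12 (val d))) (y mu2 eps2 (val d))) 0 0 = coef d.
Proof.
have [_ _ E] := hatP ord_e cardF h_gt0 (valP d).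
have e0 k : val e ^+ k != 0 := unit_exp_neq0 e k.
rewrite (nuv_at_cocycle R chF p_odd) -E /theta /mxtrace big_ord1.
rewrite (nuv_atE R chF p_odd e mu2 eps2).
set t := val e ^- (2 * val d) * v2 * _.
(* The term v2 e^eps2 is the exponent in theta, which the division by theta cancels; likewise the
   sign of mu2 in theta turns that of mu into that of mu1. *)
have -> : val e ^+ eps * val e ^- (2 * val d) * v2 = t + v2 * val e ^+ eps2.
  rewrite /t exprD; field; exact: e0.
have z0 : zeta R p ^+ trF chF (v2 * val e ^+ eps2) != 0.
  apply: contraTneq (prime_gt0 (pcharf_prime chF)) => z0; rewrite -eqn0Ngt.
  have := zetaX R (prime_gt0 (pcharf_prime chF)).
  move/eqP: z0; rewrite expf_eq0 => /andP[_ /eqP ->].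
  by rewrite expr0n; case: eqP => // _ /esym/eqP; rewrite oner_eq0.
rewrite zeta_trD -mu_eq.
move: z0; move: (zeta R p ^+ _) (zeta R p ^+ trF chF t) => z1 z2 z0.
by case: (mu1); case: (mu2); case: (nu2) => /=; field.
Qed.

(** The two sides are compared on coordinates: the one of index d' on X2 (.) X1 belongs to y2(d) (x)
    y1(d) with \hat d = d', and composing it with the braiding gives [braiding_scalar] times the
    coordinate of index d on X1 (.) X2. *)
Lemma SL2_decomposition_braiding :
  (SL2_decomposition R h chF e reps mu eps nu mu2 eps2 nu2 mu1 eps1 nu1 v2 v1 \o
    class_restr (mub mu (val e ^+ eps)) (braiding _ _) =
   diag_map chF e reps mu eps nu eps1 v1 eps2 v2
     (fun d : Hidx e h eps eps1 eps2 => coef d)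
   \o SL2_decomposition R h chF e reps mu eps nu mu1 eps1 nu1 mu2 eps2 nu2 v1 v2)%VF.
Proof.
apply/lfunP => u; apply/ffunP => d'; apply/ffunP => z.
rewrite !comp_lfunE diag_mapE.
have [dH dE] := hat_swap ord_e cardF h_gt0 (valP d').
pose d : Hidx e h eps eps1 eps2 := exist _ (hat e eps eps2 eps1 (val d')) dH.
(* [hat] is a bijection, so exactly one summand d contributes to the component d'. *)
rewrite (big_pred1 d) => [|d0]; last first.
  apply/eqP/eqP => [E|->]; last by rewrite /= dE.
  by apply: val_inj; rewrite /= -E; have [_ ->] := hat_swap ord_e cardF h_gt0 (valP d0).
have sE : summand_v e eps eps2 v2 eps1 v1 (val d') =
    summand_v e eps eps1 v1 eps2 v2 (val d) by rewrite /summand_v dE addrC.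
apply: etrans (isotypic_mapE _ _ _ _ _ _) _.
rewrite class_restrE; last exact: braiding_mor.
(* Equivariance moves the coset representative past the braiding, which leaves an identity between
   coordinates at x. *)
rewrite -braiding_act BidE [RHS]ffunE.
rewrite [X in _ *: X](isotypic_mapE _ _ _ u d z) scale_scalar_mx; congr _%:M.
rewrite sE mulrCA; congr (_ * _).
rewrite -braiding_scalar -[RHS]ind_tens_coef_braiding; first by rewrite /= dE.
  exact: power_class.
exact: mub_commute.
Qed.

End Braiding.

Theorem mainTheorem5
    (R : realType) (p n h : nat) (F K : finFieldType)
    (p_pr : prime p) (p_odd : odd p) (chF : p \in [pchar F])
    (cardF : #|F| = (p ^ n)%N) (q_ge5 : (5 <= p ^ n)%N)
    (q_eq : (p ^ n = 4 * h + 1)%N)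
    (cardK : #|K| = ((p ^ n) ^ 2)%N) (iota : {rmorphism F -> K})
    (echeck : {unit K}) (echeck_gen : generator [set: {unit K}] echeck)
    (e : {unit F}) (e_def : iota (val e) = val echeck ^+ (4 * h + 2))
    (reps : forall x : SL2 F, coset_reps x)
    (mu eps nu mu1 eps1 nu1 mu2 eps2 nu2 : bool) (v1 v2 : F)
    (mu_eq : mu1 (+) mu2 = mu) (eps_eq : eps1 (+) eps2 = eps)
    (nu_eq : nu1 (+) nu2 = nu) :
  let X1 := Bobj R chF e reps mu1 eps1 nu1 v1 in
  let X2 := Bobj R chF e reps mu2 eps2 nu2 v2 in
  let x := mub mu (val e ^+ eps) in
  let hat12 := @hat F e h eps eps1 eps2 in
  exists
    (phi12 : 'Hom(classObj (tensorObj X1 X2) x,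
                  Bsum R chF e reps h mu eps nu eps1 v1 eps2 v2))
    (phi21 : 'Hom(classObj (tensorObj X2 X1) x,
                  Bsum R chF e reps h mu eps nu eps2 v2 eps1 v1)),
  [/\ is_decomposition mu eps nu mu1 eps1 nu1 v1 mu2 eps2 nu2 v2 phi12,
      is_decomposition mu eps nu mu2 eps2 nu2 v2 mu1 eps1 nu1 v1 phi21,
      Hset e h eps eps2 eps1 = [set hat12 d | d in Hset e h eps eps1 eps2],
      (forall d, d \in Hset e h eps eps1 eps2 ->
         summand_v e eps eps2 v2 eps1 v1 (hat12 d) =
         val e ^- (2 * d) * v2 + val e ^- (2 * hat12 d) * v1) &
      (phi21 \o class_restr x (braiding X1 X2) =
       diag_map chF e reps mu eps nu eps1 v1 eps2 v2
         (fun d : Hidx e h eps eps1 eps2 =>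
           ((-1) ^+ mu) ^+ nu2 / theta (nuv_at R chF e mu2 eps2 nu2 v2)
           * zeta R p ^+ trF chF (val e ^+ eps * val e ^- (2 * val d) * v2))
       \o phi12)%VF].
Proof.
have h_gt0 : (0 < h)%N by move: q_ge5; rewrite q_eq; case: (h).
have cF : #|F| = (4 * h).+1 by rewrite cardF q_eq addn1.
have ord_e : #[e]%g = (4 * h)%N.
  (* The order comes from q^2 - 1 = 4h (4h + 2). *)
  apply: (order_unit_power echeck_gen _ _ e_def); first by rewrite addn2.
  by rewrite cardK q_eq; ring.
have mu_eq' : mu2 (+) mu1 = mu by rewrite addbC.
have nu_eq' : nu2 (+) nu1 = nu by rewrite addbC.
move=> X1 X2 x hat12.
exists (SL2_decomposition R h chF e reps mu eps nu mu1 eps1 nu1 mu2 eps2 nu2 v1 v2).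
exists (SL2_decomposition R h chF e reps mu eps nu mu2 eps2 nu2 mu1 eps1 nu1 v2 v1).
split.
- exact: SL2_decompositionP.
- exact: SL2_decompositionP.
- exact: Hset_swap.
- by move=> d; exact: summand_v_swap.
- exact: SL2_decomposition_braiding.
Qed.
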